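(* Let $2\le m<n$ and let $P(g^m,h^m)=\sum_{l\in L}a_l\,C^l(g^m,h^m)$ be a geometric scalar quantity for immersed $m$-submanifolds of Riemannian $n$-manifolds, where each $C^l$ is a complete contraction of the form $$\operatorname{contr}\big(g^{i_1j_1}\otimes\cdots\otimes g^{i_sj_s}\otimes h_{i_{s+1}j_{s+1}}\otimes\cdots\otimes h_{i_{2s}j_{2s}}\big),$$ and assume that $\int_{\mathcal M}P(g^m,h^m)\,d\mu_{g^m}$ is a global conformal invariant for $m$-submanifolds in $n$-manifolds. Then there exists a pointwise conformal invariant $W(g^m,h^{\circ})$ of weight $-m$, depending only on the traceless second fundamental form $h^\circ$ contracted with the induced metric $g^m$, such that $$P(g^m,h^m)=W(g^m,h^\circ).$$ In other words, every $C^l$, $l\in L$, is a complete contraction of weight $-m$ of the form $$\operatorname{contr}\big(g^{i_1j_1}\otimes\cdots\otimes g^{i_mj_m}\otimes h^\circ_{i_{m+1}j_{m+1}}\otimes\cdots\otimes h^\circ_{i_{2m}j_{2m}}\big).$$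
   Context: Let $f:\mathcal M^m\hookrightarrow(\bar{\mathcal M}^n,\bar g)$ be a smooth immersion into a Riemannian manifold, with induced metric $g=g^m$ and volume measure $d\mu_g$. $\bar\nabla$ is the Levi-Civita connection of $\bar g$ and $\pi_N$ the projection onto the normal bundle. $h=h^m$, $h(X,Y)=\pi_N(\bar\nabla_XY)$, is the second fundamental form; $H=\frac1m g^{ij}h_{ij}$ is the mean curvature; $h^\circ_{ij}=h_{ij}-Hg_{ij}$ is the traceless second fundamental form. Via the splitting $h_{ij}=h^\circ_{ij}+Hg_{ij}$, complete contractions in $h$ are regarded as linear combinations of complete contractions in the factors $h^\circ_{ij}$ and $Hg_{ij}$. Complete contraction: take the indicated tensor product and pair off all indices, contracting each pair with the metric (normal indices of $h$, which are suppressed in the notation, are contracted using $\bar g$; in codimension one $h$ and $H$ are regarded as scalar-valued via a unit normal). A geometric scalar quantity is a finite real linear combination of complete contractions. It has weight $k\in\mathbb Z$ if, under the rescaling $\bar g\mapsto t^2\bar g$ with constant $t>0$, it gets multiplied by $t^k$. A pointwise conformal invariant of weight $-m$ is one which under $\hat{\bar g}=e^{2\phi}\bar g$ gets multiplied pointwise by $e^{-m\phi}$, for every $\phi\in C^\infty(\bar{\mathcal M})$. Global conformal invariant: for $P$ of weight $-m$ (each $C^l$ being of weight $-m$), $\int_{\mathcal M}P\,d\mu_g$ is a global conformal invariant for $m$-submanifolds in $n$-manifolds if for every Riemannian manifold $(\bar{\mathcal M}^n,\bar g)$, every compact orientable immersed $m$-dimensional submanifold $f(\mathcal M^m)\subset\bar{\mathcal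 M}^n$ and every $\phi\in C^\infty(\bar{\mathcal M})$, setting $\hat{\bar g}=e^{2\phi}\bar g$ and denoting by hats the quantities computed with respect to $\hat{\bar g}$, one has $\int_{\mathcal M}P(\hat g,\hat h)\,d\mu_{\hat g}=\int_{\mathcal M}P(g,h)\,d\mu_g$. *)

(* Defs.v *)
From HB Require Import structures.
From mathcomp Require Import all_boot all_order all_algebra all_fingroup.
From mathcomp Require Import all_classical all_reals all_analysis.

Set Implicit Arguments.
Unset Strict Implicit.
Unset Printing Implicit Defensive.

Import Order.TTheory GRing.Theory Num.Theory.
Import numFieldNormedType.Exports.

Local Open Scope classical_set_scope.
Local Open Scope ring_scope.

Section Calculus.
Context {R : realType}.

Definition pderiv n (i : 'I_n) (f : 'rV[R]_n -> R) (x : 'rV[R]_n) : R :=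
  'D_(delta_mx 0 i) f x.

(* The set U is meant to be open. *)
Fixpoint Ck_on n (k : nat) (U : set 'rV[R]_n) (f : 'rV[R]_n -> R) : Prop :=
  (forall x, U x -> {for x, continuous f}) /\
  match k with
  | 0%N => True
  | k'.+1 => forall i : 'I_n,
      (forall x, U x -> derivable f x (delta_mx 0 i)) /\ Ck_on k' U (pderiv i f)
  end.

Definition smooth_on n (U : set 'rV[R]_n) (f : 'rV[R]_n -> R) : Prop :=
  forall k, Ck_on k U f.

Definition vsmooth_on m n (U : set 'rV[R]_m) (f : 'rV[R]_m -> 'rV[R]_n) : Prop :=
  forall j, smooth_on U (fun x => f x 0 j).

(* Row-vector convention as for 'J of derive.v: the entry (i, j) is the i-th
   partial derivative of the j-th component. *)
Definition jac m n (f : 'rV[R]_m -> 'rV[R]_n) (x : 'rV[R]_m) : 'M[R]_(m, n) :=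
  \matrix_(i, j) pderiv i (fun y => f y 0 j) x.

(* Lebesgue integral over R^n as an iterated integral (Tonelli); it is only
   applied to nonnegative Borel functions. *)
Fixpoint int_rV (n : nat) : ('rV[R]_n -> \bar R) -> \bar R :=
  match n with
  | 0%N => fun f => f 0
  | n'.+1 => fun f =>
      (\int[lebesgue_measure]_(t in [set: R])
         int_rV (fun v : 'rV[R]_n' => f (row_mx (t%:M : 'rV[R]_1) v)))%E
  end.

End Calculus.

Section Manifolds.
Context {R : realType}.

Record chart (T : Type) (n : nat) := Chart {
  dom : set T;
  to : T -> 'rV[R]_n;
  inv : 'rV[R]_n -> T }.

Definition img (T : Type) n (c : chart T n) : set 'rV[R]_n := to c @` dom c.

Definition is_chart (T : topologicalType) n (c : chart T n) : Prop :=
  [/\ open (dom c), open (img c),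
      forall p, dom c p -> inv c (to c p) = p,
      forall p, dom c p -> {for p, continuous (to c)} &
      forall x, img c x -> {for x, continuous (inv c)}].

Definition transition (T : Type) n (c d : chart T n) : 'rV[R]_n -> 'rV[R]_n :=
  to d \o inv c.

Definition compatible (T : Type) n (c d : chart T n) : Prop :=
  vsmooth_on (to c @` (dom c `&` dom d)) (transition c d).

(* Nonempty (pointed), since Borel sigma-algebras are only available on pointed
   types. The field chart_at selects a chart of the atlas around each point;
   the quantities evaluated with it below do not depend on this selection. *)
Record manifold (n : nat) := Manifold {
  carrier :> ptopologicalType;
  atlas : set (chart carrier n);
  chart_at : carrier -> chart carrier n;
  manifold_hausdorff : hausdorff_space carrier;
  manifold_countable : @second_countable carrier;
  atlas_chart : forall c, atlas c -> is_chart c;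
  atlas_compatible : forall c d, atlas c -> atlas d -> compatible c d;
  chart_at_atlas : forall p, atlas (chart_at p);
  chart_at_dom : forall p, dom (chart_at p) p }.

Definition smooth_chart n (M : manifold n) (c : chart M n) : Prop :=
  is_chart c /\ forall d, atlas d -> compatible c d /\ compatible d c.

Definition orientable n (M : manifold n) : Prop :=
  exists A : set (chart M n),
    [/\ forall c, A c -> smooth_chart c,
        forall p : M, exists2 c, A c & dom c p &
        forall c d p, A c -> A d -> dom c p -> dom d p ->
          0 < \det (jac (transition c d) (to c p))].

Definition smooth_fun n (M : manifold n) (phi : M -> R) : Prop :=
  forall c, atlas c -> smooth_on (img c) (phi \o inv c).

Definition local_rep m n (M : manifold m) (N : manifold n) (f : M -> N)
    (c : chart M m) (d : chart N n) : 'rV[R]_m -> 'rV[R]_n :=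
  to d \o f \o inv c.

Definition smooth_map m n (M : manifold m) (N : manifold n) (f : M -> N) : Prop :=
  continuous f /\
  forall c d, atlas c -> atlas d ->
    vsmooth_on (to c @` (dom c `&` f @^-1` dom d)) (local_rep f c d).

(* Tangent vectors and bilinear forms are given by their components in every
   chart of the atlas, together with the usual transformation law. *)
Definition bilin_family n (N : manifold n) := chart N n -> N -> 'M[R]_n.

Definition riemannian_metric n (N : manifold n) (G : bilin_family N) : Prop :=
  [/\ forall c, atlas c ->
        forall i j, smooth_on (img c) (fun x => G c (inv c x) i j),
      forall c q, atlas c -> dom c q -> (G c q)^T = G c q,
      forall c q, atlas c -> dom c q ->
        forall v : 'rV[R]_n, v != 0 -> 0 < (v *m G c q *m v^T) 0 0 &
      forall c d q, atlas c -> atlas d -> dom c q -> dom d q ->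
        let A := jac (transition c d) (to c q) in G c q = A *m G d q *m A^T].

End Manifolds.

Section Submanifolds.
Context {R : realType} (m n : nat).

(* A map between manifolds with a metric on the target and a vector field along
   the map; the vector field is only used in codimension one, where it is the
   unit normal through which h is regarded as scalar-valued. *)
Record submanifold := Submanifold {
  amb : manifold (R := R) n;
  src : manifold (R := R) m;
  imm : src -> amb;
  met : bilin_family amb;
  nrm : chart (R := R) amb n -> src -> 'rV[R]_n }.

Arguments imm : clear implicits.
Arguments met : clear implicits.
Arguments nrm : clear implicits.

Definition jac_at (X : submanifold) (c : chart (R := R) (src X) m)
    (d : chart (R := R) (amb X) n) (p : src X) : 'M[R]_(m, n) :=
  jac (local_rep (imm X) c d) (to c p).

Definition induced_metric (X : submanifold) c d (p : src X) : 'M[R]_m :=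
  let J := jac_at c d p in J *m met X d (imm X p) *m J^T.

(* For m even the product of m values of h does not see the sign of the unit
   normal, which may then be chosen pointwise, without any continuity; this
   covers the submanifolds which have no global continuous unit normal. *)
Definition unit_normal (X : submanifold) : Prop :=
  [/\ forall d e p, atlas d -> atlas e -> dom d (imm X p) -> dom e (imm X p) ->
        nrm X e p = nrm X d p *m jac (transition d e) (to d (imm X p)),
      forall c d (p : src X), atlas c -> atlas d -> dom c p -> dom d (imm X p) ->
        jac_at c d p *m met X d (imm X p) *m (nrm X d p)^T = 0,
      forall d p, atlas d -> dom d (imm X p) ->
        (nrm X d p *m met X d (imm X p) *m (nrm X d p)^T) 0 0 = 1 &
      odd m -> forall d p, atlas d -> dom d (imm X p) ->
        {for p, continuous (nrm X d)}].

Definition riemannian_immersion (X : submanifold) : Prop :=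
  [/\ riemannian_metric (met X), smooth_map (imm X),
      forall c d (p : src X), atlas c -> atlas d -> dom c p -> dom d (imm X p) ->
        row_free (jac_at c d p) &
      n = m.+1 -> unit_normal X].

(* The metric u^2 g on the target; the unit normal becomes u^-1 nu. *)
Definition rescale (X : submanifold) (u : amb X -> R) : submanifold :=
  @Submanifold (amb X) (src X) (imm X)
    (fun d q => u q ^+ 2 *: met X d q)
    (fun d p => (u (imm X p))^-1 *: nrm X d p).

Arguments rescale : clear implicits.

Definition homothety (X : submanifold) (t : R) : submanifold :=
  rescale X (fun=> t).

(* u = e^phi, so that the new metric is e^(2 phi) g. *)
Definition conformal (X : submanifold) (phi : amb X -> R) : submanifold :=
  rescale X (fun q => expR (phi q)).

(* Christoffel symbols of the Levi-Civita connection. *)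
Definition christoffel (X : submanifold) (d : chart (R := R) (amb X) n)
    (q : amb X) (b c : 'I_n) : 'rV[R]_n :=
  let G i j := fun y => met X d (inv d y) i j in
  let x := to d q in
  \row_a (2^-1 * \sum_e invmx (met X d q) a e *
    (pderiv b (G c e) x + pderiv c (G b e) x - pderiv e (G b c) x)).

Definition second_ff (X : submanifold) c d (p : src X) (i j : 'I_m) : 'rV[R]_n :=
  let F := local_rep (imm X) c d in
  let J := jac_at c d p in
  let v := \row_a pderiv i (pderiv j (fun y => F y 0 a)) (to c p)
           + \sum_b \sum_e (J i b * J j e) *: christoffel d (imm X p) b e in
  v - v *m met X d (imm X p) *m J^T *m invmx (induced_metric c d p) *m J.

(* Components at a point of the induced metric, the ambient metric, the (normal
   vector valued) second fundamental form or its traceless part, and the unit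
   normal. *)
Record pdata := PData {
  pg : 'M[R]_m;
  pG : 'M[R]_n;
  ph : 'I_m -> 'I_m -> 'rV[R]_n;
  pnu : 'rV[R]_n }.

Definition geom (X : submanifold) (p : src X) : pdata :=
  let c := chart_at p in let d := chart_at (imm X p) in
  PData (induced_metric c d p) (met X d (imm X p)) (second_ff c d p) (nrm X d p).

Definition mean_curvature (T : pdata) : 'rV[R]_n :=
  m%:R^-1 *: \sum_i \sum_j invmx (pg T) i j *: ph T i j.

Definition traceless (T : pdata) : pdata :=
  PData (pg T) (pG T) (fun i j => ph T i j - pg T i j *: mean_curvature T) (pnu T).

End Submanifolds.

Arguments imm {R m n} s _.
Arguments met {R m n} s _ _.
Arguments nrm {R m n} s _ _.
Arguments rescale {R m n} X u.
Arguments homothety {R m n} X t.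
Arguments conformal {R m n} X phi.
Arguments geom {R m n} X p.
Arguments induced_metric {R m n} X c d p.

(* Index pairing of contr(g^(..) (x) .. (x) g^(..) (x) h_(..) (x) .. (x) h_(..)) with
   nfac inverse metrics and nfac factors h. The slots (k, false) and (k, true) are
   the two tangential indices of the k-th inverse metric, resp. of the k-th h:
   tpair maps each upper slot to the lower slot it is contracted with, and npair
   maps each h to the one its normal index is contracted with. *)
Record contr_scheme := ContrScheme {
  nfac : nat;
  tpair : {perm 'I_nfac * bool};
  npair : {perm 'I_nfac} }.

(* In codimension one h is scalar-valued and npair is not used. *)
Definition complete_contraction (m n : nat) (C : contr_scheme) : Prop :=
  n <> m.+1 -> forall k, npair C k != k /\ npair C (npair C k) = k.

Section Invariants.
Context {R : realType} {m n : nat}.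
Implicit Types (T : @pdata R m n) (X : @submanifold R m n).

Definition inner T (v w : 'rV[R]_n) : R := (v *m pG T *m w^T) 0 0.

Definition contr (C : contr_scheme) T : R :=
  \sum_(J : {ffun 'I_(nfac C) * bool -> 'I_m})
    let hJ k := ph T (J (k, false)) (J (k, true)) in
    (\prod_k invmx (pg T) (J (tpair C (k, false))) (J (tpair C (k, true)))) *
    (if n == m.+1 then \prod_k inner T (hJ k) (pnu T)
     else \prod_(k : 'I_(nfac C) | (k < npair C k)%N) inner T (hJ k) (hJ (npair C k))).

Definition lincomb (L : finType) (a : L -> R) (C : L -> contr_scheme) T : R :=
  \sum_(l : L) a l * contr (C l) T.

Definition has_weight (Q : @pdata R m n -> R) (k : int) : Prop :=
  forall X (p : src X) (t : R), riemannian_immersion X -> 0 < t ->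
    Q (geom (homothety X t) p) = t ^ k * Q (geom X p).

Definition pointwise_conformal_invariant (Q : @pdata R m n -> R) (k : int) : Prop :=
  forall X (p : src X) (phi : amb X -> R),
    riemannian_immersion X -> smooth_fun phi ->
    Q (geom (conformal X phi) p) = expR (k%:~R * phi (imm X p)) * Q (geom X p).

Definition volume_measure X
    (mu : {measure set (g_sigma_algebraType (@open (src X))) -> \bar R}) : Prop :=
  forall (c : chart (R := R) (src X) m) (B : set (g_sigma_algebraType (@open (src X)))),
    atlas c -> measurable B -> B `<=` dom c ->
    mu B = int_rV (fun x =>
      (\1_(to c @` B) x *
       Num.sqrt (\det (induced_metric X c (chart_at (imm X (inv c x))) (inv c x))))%:E).

Arguments volume_measure : clear implicits.

Definition global_conformal_invariant (Q : @pdata R m n -> R) : Prop :=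
  forall X (phi : amb X -> R) (mu mu' : {measure set _ -> \bar R}),
    riemannian_immersion X -> compact [set: src X] -> orientable (src X) ->
    smooth_fun phi ->
    volume_measure X mu -> volume_measure (conformal X phi) mu' ->
    (\int[mu']_(p in [set: src X]) (Q (geom (conformal X phi) p))%:E =
     \int[mu]_(p in [set: src X]) (Q (geom X p))%:E)%E.

End Invariants.

(* Main.v *)
(* A conformal change of the ambient metric fixes the traceless part of h and
   shifts H by the normal gradient of phi, and the weight of P cancels the change
   of the volume. Any second fundamental form allowed at a point is attained
   at every point of one immersed torus: embed R^m / Z^m by x |-> x J
   into R^n / Z^m J, with a metric depending only on the directions transverse to
   J, whose first transverse derivatives prescribe h. Taking for phi the linear
   function dual to H, both integrands are constant, and the invariance of the
   integral over the torus is the pointwise identity P(h) = P(h - H g). *)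

Require Import Defs.
From HB Require Import structures.
From mathcomp Require Import all_boot all_order all_algebra all_fingroup.
From mathcomp Require Import all_classical all_reals all_analysis.
From mathcomp Require Import measurable_realfun ring.

Import Order.TTheory GRing.Theory Num.Theory.
Import numFieldNormedType.Exports.
Local Open Scope classical_set_scope.
Local Open Scope ring_scope.

(** * Rescaling of pointwise data *)

(** In the charts used the torus is affine, so its [h] comes from the Christoffel symbols alone, and
    the pairing of h_ij with a normal vector z is -1/2 times the z-derivative of the tangential
    block of the metric. With B(z)_ij the pairing of h_ij with z, this block must start as g - 2
    B(z). The target is not compact and B(z) grows along it, so that g - 2 B(z) may fail to be
    positive far from the torus. Adding 2 B g^-1 B makes it (g - B) g^-1 (g - B) + B g^-1 B,
    positive definite for every z, and leaves the first derivatives on the torus unchanged, as B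
    vanishes there. The function phi vanishes on the torus, so both metrics induce the same volume
    measure. It has to be constructed with finite positive mass, for the volume to be cancelled; it
    is glued from Lebesgue measure in the charts. That each contraction has m factors is read off
    from its weight, on one umbilic datum realised by the same torus. *)

Section PointwiseAlgebra.
Context {R : realType} {m n : nat}.
Implicit Types (T : @pdata R m n) (C : contr_scheme) (W : 'rV[R]_n).

(** The effect at a point of multiplying the ambient metric by u^2: [s] is the value of u there and
    [W] the normal part of the gradient of log u. As [h] is vector-valued, it is shifted but not
    scaled. *)
Definition rescale_pdata (s : R) W T : @pdata R m n :=
  PData (s ^+ 2 *: pg T) (s ^+ 2 *: pG T) (fun i j => ph T i j - pg T i j *: W)
        (s^-1 *: pnu T).

(** The involution [s] exchanges the indices below their partner with those above it, so each class
    is one half. The first class indexes the inner products of pairs of [h] in [contr]. *)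
Lemma card_npair_lt (k : nat) (s : {perm 'I_k}) :
  (forall i, s i != i /\ s (s i) = i) ->
  (2 * #|[pred i : 'I_k | (i < s i)%N]|)%N = k.
Proof.
move=> hs; rewrite -[RHS](card_ord k) -(cardC [pred i : 'I_k | (i < s i)%N]).
rewrite mul2n -addnn; congr (_ + _)%N.
rewrite -(fintype.card_image (@perm_inj _ s)); apply: eq_card => i; rewrite !inE.
apply/fintype.imageP/idP => [[j]|].
  by rewrite !inE => lt_j ->; have [_ ->] := hs j; rewrite -leqNgt ltnW.
rewrite -leqNgt => le_i; have [ne_i ss_i] := hs i.
by exists (s i); rewrite ?ss_i// inE ss_i ltn_neqAle le_i andbT.
Qed.

(** Each of the [nfac C] inverse metrics contributes s^-2. The normal contractions give back s per
    factor [h]: in codimension one s^2 from the metric and s^-1 from the unit normal, otherwise s^2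
    for each of the [nfac C] / 2 pairs. *)
Lemma contr_rescale C T s : complete_contraction m n C -> pg T \in unitmx ->
  s != 0 -> contr C (rescale_pdata s 0 T) = s ^- nfac C * contr C T.
Proof.
move=> hC uT s0; rewrite /contr mulr_sumr; apply: eq_bigr => J _.
have s2 : s ^+ 2 \is a GRing.unit by rewrite unitfE expf_neq0.
have sN : s ^+ nfac C != 0 by rewrite expf_neq0.
have -> : \prod_k invmx (pg (rescale_pdata s 0 T))
     (J (tpair C (k, false))) (J (tpair C (k, true))) =
   s ^- nfac C * s ^- nfac C * \prod_k invmx (pg T)
     (J (tpair C (k, false))) (J (tpair C (k, true))).
  rewrite /= invmxZ ?unitmxZ//.
  under eq_bigr do rewrite mxE.
  rewrite big_split/= prodr_const card_ord; congr (_ * _).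
  by rewrite -invfM exprVn -exprM mulnC exprM expr2.
rewrite -!mulrA; congr (_ * _); rewrite mulrCA; congr (_ * _).
case: ifPn => [_|/eqP nm].
  under eq_bigr => k _.
    rewrite /inner/= scaler0 subr0 -scalemxAr linearZ/= -scalemxAl -scalemxAr.
    rewrite scalerA expr2 mulfK// mxE; over.
  by rewrite big_split/= prodr_const card_ord mulKf.
have /hC hk := nm.
under eq_bigr => k _.
  rewrite /inner/= !scaler0 !subr0 -scalemxAr -scalemxAl mxE; over.
rewrite big_split/= prodr_const -exprM.
by rewrite (_ : (2 * _)%N = nfac C) ?mulKf//; exact: card_npair_lt.
Qed.

Lemma mean_curvature_rescale s W T : (0 < m)%N -> pg T \in unitmx ->
  (pg T)^T = pg T -> s != 0 ->
  mean_curvature (rescale_pdata s W T) = s ^- 2 *: (mean_curvature T - W).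
Proof.
move=> m0 uT sT s0; rewrite /mean_curvature /=.
have s2 : s ^+ 2 \is a GRing.unit by rewrite unitfE expf_neq0.
rewrite invmxZ ?unitmxZ//.
(* [W] is the normalised trace of [g W], since g^ij g_ij = m. *)
have {2}-> : W = m%:R^-1 *: \sum_i \sum_j (invmx (pg T) i j * pg T i j) *: W.
  have tr1 : \sum_i \sum_j invmx (pg T) i j * pg T i j = m%:R.
    rewrite -[RHS](mxtrace1 R m) -(mulVmx uT) /mxtrace; apply: eq_bigr => i _.
    by rewrite mxE; apply: eq_bigr => j _; congr (_ * _); rewrite -[in LHS]sT mxE.
  under eq_bigr do rewrite -scaler_suml.
  rewrite -scaler_suml tr1 scalerA mulVf ?scale1r//.
  by rewrite pnatr_eq0 -lt0n.
rewrite -scalerBr [RHS]scalerA [s ^- 2 * _]mulrC -[RHS]scalerA; congr (_ *: _).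
rewrite -sumrB scaler_sumr; apply: eq_bigr => i _.
rewrite -sumrB scaler_sumr; apply: eq_bigr => j _.
by rewrite mxE -!scalerA -scalerBr.
Qed.

Lemma traceless_rescale s W T : (0 < m)%N -> pg T \in unitmx ->
  (pg T)^T = pg T -> s != 0 ->
  traceless (rescale_pdata s W T) = rescale_pdata s 0 (traceless T).
Proof.
move=> m0 uT sT s0; rewrite {1}/traceless {1}/rescale_pdata /=; congr PData.
apply/funext => i; apply/funext => j; rewrite mean_curvature_rescale//=.
rewrite mxE scaler0 subr0 scalerA mulrAC mulfV ?expf_neq0// mul1r.
by rewrite scalerBr opprB addrA subrK.
Qed.

(** This is the change of data that the conformal factor on the torus will produce: scale 1 and
    shift H. *)
Lemma rescale_mean_curvature T : rescale_pdata 1 (mean_curvature T) T = traceless T.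
Proof. by rewrite /rescale_pdata expr1n !scale1r invr1 scale1r. Qed.

(** For h_ij = delta_ij v every term is a product of zeros and ones, and the constant index
    assignment gives 1. Hence a complete contraction is not identically zero and its weight
    determines its number of factors. *)
Lemma contr_umbilic_gt0 C (v : 'rV[R]_n) : (0 < m)%N -> v *m v^T = 1%:M ->
  0 < contr C (PData 1%:M 1%:M (fun i j : 'I_m => (i == j)%:R *: v) v).
Proof.
move=> m0 vv.
have innE (a b : bool) : inner (PData 1%:M 1%:M (fun i j : 'I_m => (i == j)%:R *: v) v)
    (a%:R *: v) (b%:R *: v) = (a && b)%:R.
  rewrite /inner/= mulmx1 linearZ/= -scalemxAl -scalemxAr scalerA vv !mxE.
  by rewrite mulr1 -natrM mulnb.
have innE1 (a : bool) : inner (PData 1%:M 1%:M (fun i j : 'I_m => (i == j)%:R *: v) v)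
    (a%:R *: v) v = a%:R.
  by have := innE a true; rewrite scale1r andbT.
rewrite /contr (bigD1 [ffun=> Ordinal m0])//= ltr_pwDl//.
  rewrite invmx1; under eq_bigr do rewrite !ffunE mxE eqxx.
  rewrite big1_eq mul1r; case: ifPn => _.
    by under eq_bigr do rewrite !ffunE innE1 eqxx; rewrite big1_eq.
  by under eq_bigr do rewrite !ffunE innE eqxx; rewrite big1_eq.
apply: sumr_ge0 => J _; apply: mulr_ge0.
  by apply: prodr_ge0 => k _; rewrite invmx1 mxE.
case: ifPn => _; apply: prodr_ge0 => k _; first by rewrite innE1.
by rewrite innE.
Qed.

End PointwiseAlgebra.

(** * Derivatives along lines and symmetry of second derivatives *)

Lemma nbhs_andS {T : topologicalType} {x : T} {P Q S : set T} :
  nbhs x P -> nbhs x Q -> (forall y, P y -> Q y -> S y) -> nbhs x S.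
Proof. by move=> xP xQ PQS; apply: filterS2 xP xQ. Qed.

Section LineDerivative.
Context {R : realType} {V : normedModType R}.
Implicit Types (f : V -> R) (x y v w : V).

Lemma is_derive_line f y v (t : R) : derivable f (y + t *: v) v ->
  is_derive t (1 : R) (fun s : R => f (y + s *: v)) ('D_v f (y + t *: v)).
Proof.
have E : (fun h : R => h^-1 *: (((fun s : R => f (y + s *: v)) \o shift t) (h *: 1)
     - f (y + t *: v))) =
   (fun h => h^-1 *: ((f \o shift (y + t *: v)) (h *: v) - f (y + t *: v))).
  apply/funext => h /=; congr (_ *: (f _ - _)).
  by rewrite [h *: 1]mulr1 scalerDl addrCA.
by move=> df; split; rewrite /derivable /derive E.
Qed.

Lemma is_derive_lineP f x v (l : R) :
  is_derive (0 : R) (1 : R) (fun h : R => f (h *: v + x)) l -> is_derive x v f l.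
Proof.
have E : (fun h : R => h^-1 *: (((fun h : R => f (h *: v + x)) \o shift 0) (h *: 1)
     - f (0 *: v + x))) =
   (fun h => h^-1 *: ((f \o shift x) (h *: v) - f x)).
  by apply/funext => h /=; rewrite addr0 scale0r add0r [h *: 1]mulr1.
by move=> [df <-]; split; [move: df|]; rewrite /derivable /derive E.
Qed.

(** Used for coordinates, affine maps, linear forms and the model metric, all at most quadratic
    along lines. *)
Lemma is_derive_quadratic f x v (b c : R) :
  (forall h : R, f (h *: v + x) = f x + h * b + h ^+ 2 * c) -> is_derive x v f b.
Proof.
move=> fE; apply: is_derive_lineP; rewrite (funext fE).
have H : is_derive (0 : R) (1 : R)
    (fun h : R => cst (f x) h + h * b + h ^+ 2 * c) (0 + b *: 1 + c *: 0).
  apply: is_deriveD.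
    apply: is_deriveD.
    have := @is_deriveZ R R R id b 0 1 1 (is_derive_id _ _).
    have -> // : (b \*: id) = (fun h : R => h * b).
    by apply/funext => h; rewrite /= [RHS]mulrC.
  have := @is_deriveZ R R R (fun h : R => h ^+ 2) c 0 1 0.
  have -> : (c \*: (fun h : R => h ^+ 2)) = (fun h : R => h ^+ 2 * c).
    by apply/funext => h; rewrite /= [RHS]mulrC.
  apply; have -> : (fun h : R => h ^+ 2) = id ^+ 2 :> (R -> R).
    by apply/funext => h; rewrite !expr2.
  have := @is_deriveX R R id 2 0 1 1 (is_derive_id _ _).
  by rewrite expr1 mulr0 scale0r.
by move: H; rewrite scaler0 addr0 add0r [b *: 1]mulr1.
Qed.

Lemma is_derive_expR_comp f x v (l : R) :
  is_derive x v f l -> is_derive x v (fun y => expR (f y)) (expR (f x) * l).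
Proof.
move=> df; apply: is_derive_lineP.
have H : is_derive (0 : R) (1 : R) (fun h : R => f (h *: v + x)) l.
  have df' : derivable f (x + 0 *: v) v by rewrite scale0r addr0; case: df.
  have := @is_derive_line f x v 0 df'; rewrite scale0r addr0.
  have -> : 'D_v f x = l by case: df.
  by under [X in is_derive _ _ X _]eq_fun do rewrite addrC.
have := @is_derive1_comp R expR _ 0 _ _ (is_derive_expR _) H.
by rewrite /= scale0r add0r.
Qed.

(** The mean value theorem twice: in the direction w for the difference of [f] along two parallel
    segments, and in the direction v for the derivative of [f] along w. *)
Lemma second_difference f x v w (s : R) : 0 < s ->
  (forall a b, 0 <= a <= s -> 0 <= b <= s ->
     derivable f (x + a *: v + b *: w) w /\
     derivable ('D_w f) (x + a *: v + b *: w) v) ->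
  exists a b, [/\ 0 <= a <= s, 0 <= b <= s &
    f (x + s *: v + s *: w) - f (x + s *: v) - f (x + s *: w) + f x =
    s * s * 'D_v ('D_w f) (x + a *: v + b *: w)].
Proof.
move=> s0 df.
have s0' : 0 <= s <= s by rewrite lexx ltW.
have s00 : 0 <= (0 : R) <= s by rewrite lexx ltW.
have subI t : t \in `]0, s[%R -> 0 <= t <= s.
  by rewrite in_itv/= => /andP[/ltW -> /ltW ->].
have subI' t : t \in `[0, s]%R -> 0 <= t <= s by rewrite in_itv.
pose phi t := f (x + s *: v + t *: w) - f (x + t *: w).
pose dphi t := 'D_w f (x + s *: v + t *: w) - 'D_w f (x + t *: w).
have phi' t : 0 <= t <= s -> is_derive t (1 : R) phi (dphi t).
  move=> ts; apply: is_deriveB; apply: is_derive_line; first by have [] := df _ _ s0' ts.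
  by have [+ _] := df _ _ s00 ts; rewrite scale0r addr0.
have [|||b /subI bs Eb] := @MVT R phi dphi 0 s.
- by [].
- by move=> t /subI; exact: phi'.
- by apply: derivable_within_continuous => t /subI' /phi'[].
pose psi r := 'D_w f (x + b *: w + r *: v).
pose dpsi r := 'D_v ('D_w f) (x + b *: w + r *: v).
have psi' t : 0 <= t <= s -> is_derive t (1 : R) psi (dpsi t).
  by move=> ts; apply: is_derive_line; have [_] := df _ _ ts bs; rewrite addrAC.
have [|||a /subI as_ Ea] := @MVT R psi dpsi 0 s.
- by [].
- by move=> t /subI; exact: psi'.
- by apply: derivable_within_continuous => t /subI' /psi'[].
exists a, b; split=> //.
move: Eb Ea; rewrite /phi /dphi /psi /dpsi !scale0r !addr0 !subr0.
rewrite ![x + b *: w + _]addrAC => Eb Ea.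
by rewrite [RHS]mulrC mulrA -Ea -Eb; ring.
Qed.

(** Schwarz's theorem. The second difference is symmetric in v and w, so on arbitrarily small
    parallelograms at x the two mixed derivatives share a value, taken at possibly different points;
    continuity carries this to x. *)
Lemma derive_comm f x v w : (\forall y \near x, derivable f y w /\ derivable f y v) ->
  (\forall y \near x, derivable ('D_w f) y v /\ derivable ('D_v f) y w) ->
  {for x, continuous ('D_v ('D_w f))} -> {for x, continuous ('D_w ('D_v f))} ->
  'D_v ('D_w f) x = 'D_w ('D_v f) x.
Proof.
move=> df ddf c1 c2; apply/eqP; rewrite -subr_eq0 -normr_le0.
apply/ler_addgt0Pr => e e0; rewrite add0r.
have e20 : 0 < e / 2 by rewrite divr_gt0.
have : \forall y \near x, [/\ derivable f y w, derivable f y v,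
   derivable ('D_w f) y v, derivable ('D_v f) y w &
   `|'D_v ('D_w f) x - 'D_v ('D_w f) y| < e / 2 /\
   `|'D_w ('D_v f) x - 'D_w ('D_v f) y| < e / 2].
  have n1 := @cvgr_dist_lt _ _ _ _ _ _ _ c1 _ e20.
  have n2 := @cvgr_dist_lt _ _ _ _ _ _ _ c2 _ e20.
  have {}n1 := n1 (nbhs_filter x); have {}n2 := n2 (nbhs_filter x).
  refine (nbhs_andS (nbhs_andS df ddf (fun y => @conj _ _))
    (nbhs_andS n1 n2 (fun y => @conj _ _)) _).
  by move=> y [[h1 h2] [h3 h4]] h5; exact: And5 h1 h2 h3 h4 h5.
rewrite -nbhs_nearE => /nbhs_ballP[d /= d0 Hd].
(* The parallelogram with sides [s v] and [s w] stays in the ball of radius [d]; the 1 keeps the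
   denominator positive when v = w = 0. *)
pose s := d / (`|v| + `|w| + 1).
have K0 : 0 < `|v| + `|w| + 1 by rewrite ltr_wpDl// addr_ge0.
have s0 : 0 < s by rewrite divr_gt0.
have inb a b : 0 <= a <= s -> 0 <= b <= s -> ball x d (x + a *: v + b *: w).
  move=> /andP[a0 as_] /andP[b0 bs].
  rewrite -ball_normE /ball_/= -addrA opprD addNKr normrN.
  apply: (le_lt_trans (ler_normD _ _)); rewrite !normrZ !ger0_norm//.
  apply: (@le_lt_trans _ _ (s * (`|v| + `|w|))).
    by rewrite mulrDr lerD// ler_wpM2r.
  rewrite /s mulrAC -mulrA gtr_pMr// ltr_pdivrMr// mul1r ltrDl//.
have [|a [b [ha hb E1]]] := @second_difference f x v w s s0.
  by move=> a b ha hb; have [] := Hd _ (inb _ _ ha hb).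
have [|b' [a' [hb' ha' E2]]] := @second_difference f x w v s s0.
  by move=> b' a' hb' ha'; rewrite addrAC; have [] := Hd _ (inb _ _ ha' hb').
have E : 'D_v ('D_w f) (x + a *: v + b *: w) =
         'D_w ('D_v f) (x + b' *: w + a' *: v).
  have ss : s * s != 0 by rewrite mulf_neq0// gt_eqF.
  apply: (mulfI ss); rewrite -E1 -E2 [x + s *: v + _]addrAC; ring.
have [_ _ _ _ [h1 _]] := Hd _ (inb _ _ ha hb).
have [_ _ _ _ [_ h2]] := Hd _ (inb _ _ ha' hb').
move: h1 h2; rewrite E [x + b' *: w + _]addrAC => h1 h2.
rewrite (splitr e); apply: ltW; apply: le_lt_trans (ltrD h1 h2).
by rewrite [in X in _ <= _ + X]distrC; apply: le_trans (ler_normD _ _); rewrite addrA subrK.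
Qed.

End LineDerivative.

(** * Smooth functions on R^n *)

Section Smoothness.
Context {R : realType} {n : nat}.
Implicit Types (f g : 'rV[R]_n -> R) (U : set 'rV[R]_n).

Lemma near_eq_continuous_at {T S : topologicalType} (f g : T -> S) (x : T) :
  (\near x, f x = g x) -> {for x, continuous g} -> {for x, continuous f}.
Proof.
move=> fg cg; have fgx : f x = g x := nbhs_singleton fg.
rewrite /prop_for /continuous_at fgx; apply: cvg_trans cg.
by apply: near_eq_cvg; apply: filterS fg => y ->.
Qed.

Lemma Ck_onW k U f : Ck_on k.+1 U f -> Ck_on k U f.
Proof.
elim: k f => [|k IH] f [cf df]; split=> // i; have [? ?] := df i; split=> //.
exact: IH.
Qed.

(** Coordinate expressions on the quotients agree with globally smooth maps only near each point,
    which is enough. *)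
Lemma Ck_on_local k U f :
  (forall x, U x -> exists g, Ck_on k setT g /\ \near x, f x = g x) -> Ck_on k U f.
Proof.
have cont_of k' g x : Ck_on k' setT g -> {for x, continuous g}.
  by case: k' => [|k'] [cg _]; exact: cg.
elim: k f => [|k IH] f H; split.
- by move=> x /H[g [/cont_of cg fg]]; exact: near_eq_continuous_at fg (cg x).
- by [].
- by move=> x /H[g [/cont_of cg fg]]; exact: near_eq_continuous_at fg (cg x).
move=> i; split=> [x /H[g [[_ /(_ i)[dg _]] fg]]|].
  apply: near_eq_derivable (dg x I); apply: filterS fg => y; exact: esym.
apply: IH => x /H[g [[_ /(_ i)[_ dg]] fg]]; exists (pderiv i g); split=> //.
(* Equality near [x] is equality near every point close to [x], so it passes to the partial
   derivatives. *)
have := nbhs_interior fg; apply: filterS => y fgy.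
exact: near_eq_derive fgy.
Qed.

Lemma Ck_on_sub k U U' f : U' `<=` U -> Ck_on k U f -> Ck_on k U' f.
Proof.
move=> UU'; elim: k f => [|k IH] f [cf df]; split=> //.
- by move=> x /UU' /cf.
- by move=> x /UU' /cf.
by move=> i; have [dx /IH] := df i; split=> // x /UU' /dx.
Qed.

Notation smooth := (smooth_on [set: 'rV[R]_n]).

Lemma smooth_on_local U f :
  (forall x, U x -> exists g, smooth g /\ \near x, f x = g x) -> smooth_on U f.
Proof.
by move=> H k; apply: Ck_on_local => x /H[g [sg fg]]; exists g; split=> //; exact: sg.
Qed.

Lemma smooth_on_sub U f : smooth f -> smooth_on U f.
Proof. by move=> sf k; exact: (@Ck_on_sub k setT). Qed.

Lemma smooth_pderivE f (d : 'I_n -> 'rV[R]_n -> R) :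
  continuous f -> (forall i x, is_derive x (delta_mx 0 i) f (d i x)) ->
  (forall i, smooth (d i)) -> smooth f.
Proof.
move=> cf df sd [|k]; first by split=> // x _; exact: cf.
split=> [x _|i]; first exact: cf.
split=> [x _|]; first by case: (df i x).
have -> : pderiv i f = d i; last exact: sd.
by apply/funext => x; rewrite /pderiv; case: (df i x).
Qed.

Lemma smooth_cst (c : R) : smooth (cst c).
Proof.
move=> k; elim: k c => [|k IH] c; split=> //; try by move=> x _; exact: cst_continuous.
move=> i; split=> [x _|]; first exact: derivable_cst.
have -> : pderiv i (cst c) = cst (0 : R); last exact: IH.
by apply/funext => x; rewrite /pderiv derive_cst.
Qed.

Lemma smooth_coord j : smooth (fun x => x 0 j).
Proof.
apply: (@smooth_pderivE _ (fun i => cst ((i == j)%:R : R))).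
- exact: coord_continuous.
- move=> i x; apply: (@is_derive_quadratic _ _ _ _ _ _ 0) => h.
  by rewrite mulr0 addr0 addrC !mxE eqxx/= eq_sym.
- by move=> i; exact: smooth_cst.
Qed.

Lemma Ck_onD k f g : Ck_on k setT f -> Ck_on k setT g ->
  Ck_on k setT (fun x => f x + g x).
Proof.
elim: k f g => [|k IH] f g [cf df] [cg dg].
  by split=> // x _; exact: (cvgD (cf x I) (cg x I)).
split; first by move=> x _; exact: (cvgD (cf x I) (cg x I)).
move=> i; have [fi si] := df i; have [gi ti] := dg i; split.
  by move=> x _; exact: derivableD (fi x I) (gi x I).
have -> : pderiv i (fun x => f x + g x) = (fun x => pderiv i f x + pderiv i g x).
  by apply/funext => x; exact: deriveD (fi x I) (gi x I).
exact: IH.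
Qed.

Lemma Ck_onM k f g : Ck_on k setT f -> Ck_on k setT g ->
  Ck_on k setT (fun x => f x * g x).
Proof.
elim: k f g => [|k IH] f g Cf Cg; have [cf df] := Cf; have [cg dg] := Cg.
  by split=> // x _; exact: (cvgM (cf x I) (cg x I)).
split; first by move=> x _; exact: (cvgM (cf x I) (cg x I)).
move=> i; have [fi si] := df i; have [gi ti] := dg i; split.
  by move=> x _; exact: derivableM (fi x I) (gi x I).
have -> : pderiv i (fun x => f x * g x) =
    (fun x => f x * pderiv i g x + g x * pderiv i f x).
  by apply/funext => x; exact: deriveM (fi x I) (gi x I).
by apply: Ck_onD; apply: IH => //; exact: Ck_onW.
Qed.

Lemma smoothD f g : smooth f -> smooth g -> smooth (fun x => f x + g x).
Proof. by move=> sf sg k; exact: Ck_onD. Qed.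

Lemma smoothM f g : smooth f -> smooth g -> smooth (fun x => f x * g x).
Proof. by move=> sf sg k; exact: Ck_onM. Qed.

Lemma smooth_sum (I : Type) (r : seq I) (F : I -> 'rV[R]_n -> R) :
  (forall i, smooth (F i)) -> smooth (fun x => \sum_(i <- r) F i x).
Proof.
move=> sF; elim: r => [|i r IH].
  by under eq_fun do rewrite big_nil; exact: smooth_cst.
by under eq_fun do rewrite big_cons; exact: smoothD.
Qed.

Definition mx_smooth {p q} (A : 'rV[R]_n -> 'M[R]_(p, q)) :=
  forall i j, smooth (fun x => A x i j).

Lemma mx_smooth_cst {p q} (A : 'M[R]_(p, q)) : mx_smooth (fun=> A).
Proof. by move=> i j; exact: smooth_cst. Qed.

Lemma mx_smooth_id : mx_smooth id.
Proof. by move=> i j; rewrite (ord1 i); exact: smooth_coord. Qed.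

Lemma mx_smooth_tr {p q} (A : 'rV[R]_n -> 'M[R]_(p, q)) :
  mx_smooth A -> mx_smooth (fun x => (A x)^T).
Proof. by move=> sA i j; under eq_fun do rewrite mxE; exact: sA. Qed.

Lemma mx_smoothD {p q} (A B : 'rV[R]_n -> 'M[R]_(p, q)) :
  mx_smooth A -> mx_smooth B -> mx_smooth (fun x => A x + B x).
Proof.
by move=> sA sB i j; under eq_fun do rewrite mxE; apply: smoothD; [exact: sA|exact: sB].
Qed.

Lemma mx_smoothZ {p q} c (A : 'rV[R]_n -> 'M[R]_(p, q)) :
  mx_smooth A -> mx_smooth (fun x => c *: A x).
Proof.
by move=> sA i j; under eq_fun do rewrite mxE; apply: smoothM; [exact: smooth_cst|exact: sA].
Qed.

Lemma mx_smoothM {p q r} (A : 'rV[R]_n -> 'M[R]_(p, q)) (B : 'rV[R]_n -> 'M[R]_(q, r)) :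
  mx_smooth A -> mx_smooth B -> mx_smooth (fun x => A x *m B x).
Proof.
move=> sA sB i j; under eq_fun do rewrite mxE; apply: smooth_sum => k.
by apply: smoothM; [exact: sA|exact: sB].
Qed.

Lemma pderiv_comm U f (x : 'rV[R]_n) i j : nbhs x U -> Ck_on 2 U f ->
  pderiv i (pderiv j f) x = pderiv j (pderiv i f) x.
Proof.
move=> xU [_ df]; have [di [_ ddi]] := df i; have [dj [_ ddj]] := df j.
have [dji [cji _]] := ddj i; have [dij [cij _]] := ddi j.
have Ux := nbhs_singleton xU.
apply: derive_comm; [| |exact: cji|exact: cij].
- by apply: filterS xU => y Uy; exact: conj (dj y Uy) (di y Uy).
- by apply: filterS xU => y Uy; exact: conj (dji y Uy) (dij y Uy).
Qed.

End Smoothness.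

(** * Lebesgue measure on R^n *)

Section Lebesgue.
Local Set Implicit Arguments.
Local Unset Strict Implicit.
Context {R : realType}.

(** A countable basis of R^n, serving both measurability on R^n and second countability of the
    quotients. *)
Definition rat_ball n (qk : 'rV[rat]_n * nat) : set 'rV[R]_n :=
  ball (map_mx ratr qk.1 : 'rV[R]_n) qk.2.+1%:R^-1.

Lemma rat_ball_basis n (x : 'rV[R]_n) V : nbhs x V ->
  exists qk, rat_ball qk x /\ rat_ball qk `<=` V.
Proof.
move=> /nbhs_ballP[e /= e0 eV].
have [k] := @ltr_add_invr R 0 (e / 2) (divr_gt0 e0 (ltr0n _ 2)).
rewrite add0r => ke.
have k0 : 0 < k.+1%:R^-1 :> R by rewrite invr_gt0.
have hq i : exists q : rat, ball (x 0 i) (k.+1%:R^-1 : R) (ratr q).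
  have lt : x 0 i - k.+1%:R^-1 < x 0 i + k.+1%:R^-1.
    by rewrite ltrBlDr -addrA ltrDl addr_gt0.
  by have [q] := rat_in_itvoo lt; exists q; rewrite ball_itv.
pose q : 'rV[rat]_n := \row_i projT1 (cid (hq i)).
have xq : ball x (k.+1%:R^-1 : R) (map_mx ratr q : 'rV[R]_n).
  split=> // i j; rewrite !mxE (ord1 i); exact: (projT2 (cid (hq j))).
exists (q, k); split; first exact: ball_sym.
move=> y qy; apply: eV; rewrite [e]splitr; apply: ball_triangle.
  exact: le_ball (ltW ke) _ xq.
exact: le_ball (ltW ke) _ qy.
Qed.

Lemma open_rat_ballE n (U : set 'rV[R]_n) : open U ->
  U = \bigcup_(qk in [set qk | rat_ball qk `<=` U]) rat_ball qk.
Proof.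
move=> oU; apply/seteqP; split=> [x Ux|x [qk h /h]//].
have [qk [qx qU]] := rat_ball_basis (open_nbhs_nbhs (conj oU Ux)).
by exists qk.
Qed.

Definition borel_rV n := g_sigma_algebraType (@open 'rV[R]_n).

Lemma open_borel_measurable {T : ptopologicalType} (U : set T) : open U ->
  measurable (U : set (g_sigma_algebraType (@open T))).
Proof. exact: sub_sigma_algebra. Qed.

Lemma continuous_borel_measurable {T S : ptopologicalType} (f : T -> S) :
  continuous f -> measurable_fun setT
   (f : g_sigma_algebraType (@open T) -> g_sigma_algebraType (@open S)).
Proof.
move=> /continuousP cf; apply: (@measurability _ _ (g_sigma_algebraType (@open T))
  (g_sigma_algebraType (@open S)) setT f (@open S)) => //.
by move=> _ [U oU <-]; rewrite setTI; apply: open_borel_measurable; exact: cf.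
Qed.

(** Mirrors the [row_mx] of [int_rV], so that a product measure pushed forward along it is computed
    by the iterated integral. *)
Definition cons_rV n (tv : measurableTypeR R * borel_rV n) : borel_rV n.+1 :=
  row_mx (tv.1%:M : 'rV[R]_1) tv.2.

Lemma cons_rV0 n tv : @cons_rV n tv 0 0 = tv.1.
Proof.
have E : lshift n (0 : 'I_1) = 0 :> 'I_(1 + n) by exact: val_inj.
have := row_mxEl (tv.1%:M : 'rV[R]_1) (tv.2 : 'rV[R]_n) 0 0.
by rewrite E => H; rewrite [LHS]H mxE eqxx mulr1n.
Qed.

Lemma cons_rVS n tv i : @cons_rV n tv 0 (lift 0 i) = (tv.2 : 'rV[R]_n) 0 i.
Proof.
have E : rshift 1 i = lift 0 i :> 'I_(1 + n) by exact: val_inj.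
by have := row_mxEr (tv.1%:M : 'rV[R]_1) (tv.2 : 'rV[R]_n) 0 i; rewrite E.
Qed.

Lemma cons_rVD n t v (a : 'rV[R]_n.+1) : @cons_rV n (t, v) + a =
  cons_rV (t + a 0 0, (v : 'rV[R]_n) + (\row_(i < n) a 0 (lift 0 i))) :> 'rV[R]_n.+1.
Proof.
apply/rowP => j; rewrite mxE.
by case: (unliftP 0 j) => [k|] ->; rewrite ?cons_rV0 ?cons_rVS ?mxE.
Qed.

(** Row vectors carry the sup norm, so balls are boxes. *)
Lemma cons_rV_ball n (a : 'rV[R]_n.+1) (r : R) :
  @cons_rV n @^-1` (ball a r) =
  ball (a 0 0) r `*` ball (\row_(i < n) a 0 (lift 0 i)) r.
Proof.
apply/seteqP; split=> tv.
  move=> [r0 h]; split; first by have := h 0 0; rewrite cons_rV0.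
  by split=> // i j; rewrite mxE (ord1 i) -cons_rVS.
move=> [/= h0 [r0 h]]; split=> // i j; rewrite (ord1 i).
by case: (unliftP 0 j) => [k|] ->; rewrite ?cons_rV0// cons_rVS; have := h 0 k; rewrite mxE.
Qed.

(** An open set is a countable union of rational balls, which pull back to measurable rectangles. *)
Lemma measurable_cons_rV n : measurable_fun setT (@cons_rV n).
Proof.
apply: (@measurability _ _ (measurableTypeR R * borel_rV n)%type
  (borel_rV n.+1) setT (@cons_rV n) (@open 'rV[R]_n.+1)) => //.
move=> _ [U oU <-]; rewrite setTI (open_rat_ballE oU) preimage_bigcup.
rewrite bigcup_mkcond; apply: countable_bigcupT_measurable => [|qk].
  exact: countableP.
case: ifPn => // _; rewrite cons_rV_ball; apply: measurableX.
  by rewrite ball_itv; exact: measurable_itv.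
by apply: open_borel_measurable; exact: ball_open.
Qed.

Lemma ex_pushforward d d' (T1 : measurableType d) (T2 : measurableType d')
    (m : {measure set T1 -> \bar R}) (f : T1 -> T2) :
  measurable_fun setT f ->
  exists nu : {measure set T2 -> \bar R}, forall A, nu A = m (f @^-1` A).
Proof. by move=> mf; unshelve eexists (pushforward m f). Qed.

Lemma measurable_translate (a : R) :
  measurable_fun setT ((fun x => x + a) : measurableTypeR R -> measurableTypeR R).
Proof. by apply: continuous_measurable_fun => x; apply: cvgD; [exact: cvg_id|exact: cvg_cst]. Qed.

(** By uniqueness of Lebesgue measure: the translated measure has the same values on half-open
    intervals. *)
Lemma lebesgue_measure_translate (a : R) (A : set (measurableTypeR R)) :
  measurable A -> lebesgue_measure [set x | A (x + a)] = lebesgue_measure A.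
Proof.
move=> mA; have [nu nuE] := ex_pushforward lebesgue_measure (measurable_translate a).
rewrite -[LHS]nuE; apply/esym.
apply: lebesgue_measure_unique mA => _ [[x y] _ <-] /=; rewrite nuE.
rewrite (_ : _ @^-1` _ = `](x - a), (y - a)]%classic); last first.
  apply/seteqP; split=> z /=; rewrite !in_itv/= ltrBlDr lerBrDr//.
rewrite [LHS]lebesgue_measure_itv [RHS](lebesgue_measure_itv `](x - a), (y - a)]) /= !lte_fin ltrD2r; case: ifPn => // _.
by rewrite -!EFinD; congr _%:E; ring.
Qed.

Lemma integral_translate (a : R) (F : R -> \bar R) :
  measurable_fun [set: measurableTypeR R] F -> (forall x, (0 <= F x)%E) ->
  (\int[lebesgue_measure]_(x in [set: R]) F (x + a)%R =
   \int[lebesgue_measure]_(x in [set: R]) F x)%E.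
Proof.
move=> mF F0.
have := ge0_integral_pushforward (measurable_translate a) lebesgue_measure measurableT mF (fun y _ => F0 y).
rewrite preimage_setT => <-; apply: eq_measure_integral => [|mf A mA _]; first exact: measurable_translate.
exact: lebesgue_measure_translate.
Qed.

(** The measure in one dimension becomes a factor of a product in the next, which asks for
    sigma-finiteness; balls of integer radius exhaust R^n. *)
Lemma ex_sigma_finite n (nu : {measure set (borel_rV n) -> \bar R}) :
  (forall r : R, 0 < r -> (nu (ball (0%R : 'rV[R]_n) r) < +oo)%E) ->
  exists mu : {sigma_finite_measure set (borel_rV n) -> \bar R}, forall A, mu A = nu A.
Proof.
move=> nuf.
have sf : sigma_finite setT nu.
  exists (fun k : nat => ball (0 : 'rV[R]_n) k.+1%:R).
    apply/esym; rewrite -subTset => x _; have [k xk] := ltr_add_invr (ltr0n R 1).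
    exists (Num.truncn `|x|) => //; rewrite -ball_normE /ball_/= sub0r normrN.
    by rewrite truncnS_gt.
  move=> k; split; first by apply: open_borel_measurable; exact: ball_open.
  exact: nuf.
pose H0 := Measure.class nu.
pose H1 := isSFinite.Build _ _ _ (Measure.sort nu)
  (sfinite_measure_sigma_finite sf).
pose H2 := isSigmaFinite.Build _ _ _ (Measure.sort nu) sf.
pose mu : {sigma_finite_measure set (borel_rV n) -> \bar R} :=
  HB.pack_for (SigmaFiniteMeasure.type (borel_rV n) R) (Measure.sort nu) H0 H1 H2.
by exists mu.
Qed.

(** [kap] times Lebesgue measure on R^n, built as a product one coordinate at a time. It will be the
    volume measure in charts, with [kap] the constant density of the induced metric. *)
Lemma ex_leb n (kap : R) : 0 < kap ->
  exists mu : {sigma_finite_measure set (borel_rV n) -> \bar R},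
   [/\ forall B, measurable B -> mu B = int_rV (fun x => (\1_B x * kap)%:E),
      forall (B : set (borel_rV n)) (a : 'rV[R]_n), measurable B ->
        mu [set x : 'rV[R]_n | B (x + a)] = mu B &
      forall (a : 'rV[R]_n) (r : R), 0 < r ->
        exists2 c : R, 0 < c & mu (ball a r) = c%:E].
Proof.
move=> kap0; elim: n => [|n [leb [lebE lebT lebB]]].
  pose nu : {measure set (borel_rV 0) -> \bar R} :=
    mscale (NngNum (ltW kap0)) (dirac ((0 : 'rV[R]_0) : borel_rV 0)).
  have nuE B : nu B = (\1_B (0 : 'rV[R]_0) * kap)%:E.
    by rewrite /nu /= /mscale/= diracE indicE muleC.
  have [r r0|mu muE] := ex_sigma_finite (nu := nu).
    by rewrite nuE ltry.
  exists mu; split=> [B _|B a _|a r r0]; rewrite !muE !nuE //=.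
    congr (_ * _)%:E; rewrite !indicE; congr (_%:R); congr (nat_of_bool _).
    by apply/idP/idP; rewrite !inE/= (thinmx0 (0 + a)).
  exists kap => //; rewrite indicE mem_set ?mul1r//.
  by rewrite (thinmx0 a); exact: ballxx.
have [nu nuE] := ex_pushforward (lebesgue_measure \x leb)%E (@measurable_cons_rV n).
have secE B : nu B = (\int[lebesgue_measure]_(t in [set: R])
    leb (xsection (@cons_rV n @^-1` B) t))%E by rewrite nuE.
have mcons (B : set (borel_rV n.+1)) : measurable B -> measurable (@cons_rV n @^-1` B).
  by move=> mB; rewrite -[X in measurable X]setTI; exact: measurable_cons_rV.
have nuB (a : 'rV[R]_n.+1) (r : R) : 0 < r ->
    exists2 c : R, 0 < c & nu (ball a r) = c%:E.
  move=> r0; have [c c0 E] := lebB (\row_(i < n) a 0 (lift 0 i)) r r0.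
  exists (r *+ 2 * c); first by rewrite mulr_gt0// mulrn_wgt0.
  rewrite nuE cons_rV_ball EFinM -E -(lebesgue_measure_ball (a 0 0) (ltW r0)).
  apply: product_measure1E; first by rewrite ball_itv; exact: measurable_itv.
  by apply: open_borel_measurable; exact: ball_open.
have [r r0|mu muE] := ex_sigma_finite (nu := nu).
  by have [c _ ->] := nuB 0 r r0; rewrite ltry.
exists mu; split=> [B mB|B a mB|a r r0]; rewrite !muE.
- rewrite secE /=; apply: eq_integral => t _.
  rewrite lebE; last by apply: measurable_xsection; exact: mcons.
  congr int_rV; apply/funext => v; congr (_ * _)%:E.
  by rewrite !indicE; congr (_%:R); congr (nat_of_bool _); rewrite mem_xsection;
    apply/idP/idP; rewrite !inE.
- rewrite !secE.
  pose F t := leb (xsection (@cons_rV n @^-1` B) t).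
  (* The translation acts separately on the first coordinate and on each slice. *)
  rewrite -(integral_translate (a 0 0) (F := F)).
  + apply: eq_integral => t _; rewrite /F.
    rewrite -[RHS](lebT _ (\row_(i < n) a 0 (lift 0 i))); last first.
      by apply: measurable_xsection; exact: mcons.
    by congr (leb _); apply/seteqP; split=> v /=; rewrite /xsection/= !inE/= cons_rVD.
  + by apply: measurable_fun_xsection; exact: mcons.
  + by move=> t; exact: measure_ge0.
- exact: nuB.
Qed.

End Lebesgue.

(** * Quotients of R^n by lattices *)

Lemma translate_continuous {R : realType} {V : normedModType R} (k : V) :
  continuous (fun x : V => x + k).
Proof. by move=> x; apply: (@cvgD _ _ _ _ _ id (cst k)); [exact: cvg_id|exact: cvg_cst]. Qed.

Section LatticeQuotient.
Local Set Implicit Arguments.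
Local Unset Strict Implicit.
Context {R : realType} {m n : nat} (J : 'M[R]_(m, n)).
Local Open Scope quotient_scope.

(** Integer combinations of the rows of [J]. The target is the quotient by this lattice, the source
    the quotient for the identity matrix. *)
Definition lat : set 'rV[R]_n := [set v | exists z : 'rV[int]_m, v = map_mx intr z *m J].

Lemma lat0 : lat 0. Proof. by exists 0; rewrite raddf0 mul0mx. Qed.

Lemma latN v : lat v -> lat (- v).
Proof. by move=> [z ->]; exists (- z); rewrite raddfN mulNmx. Qed.

Lemma latD v w : lat v -> lat w -> lat (v + w).
Proof. by move=> [z ->] [t ->]; exists (z + t); rewrite raddfD mulmxDl. Qed.

Definition lat_eq : rel 'rV[R]_n := fun x y => `[< lat (x - y) >].

Lemma lat_eq_equiv : equiv_class_of lat_eq.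
Proof.
split=> [x|x y|y x z].
- by apply/asboolP; rewrite subrr; exact: lat0.
- by apply/asboolP/asboolP => /latN; rewrite opprB.
- move=> /asboolP xy /asboolP yz; apply/asboolP.
  by rewrite -(subrK y x) -addrA; exact: latD.
Qed.

Canonical lat_equiv := EquivRelPack lat_eq_equiv.

Definition qsp : ptopologicalType := quotient_topology {eq_quot lat_equiv}.
Definition qpi (x : 'rV[R]_n) : qsp := \pi_({eq_quot lat_equiv}) x.
Definition qrepr (p : qsp) : 'rV[R]_n := generic_quotient.repr (p : {eq_quot lat_equiv}).

Lemma qreprK p : qpi (qrepr p) = p. Proof. exact: reprK. Qed.

Lemma qpiP x y : qpi x = qpi y <-> lat (x - y).
Proof.
split=> [/eqmodP/asboolP//|h]; exact/eqmodP/asboolP.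
Qed.

Lemma qpiD x k : lat k -> qpi (x + k) = qpi x.
Proof. by move=> lk; apply/qpiP; rewrite addrC addKr. Qed.

Lemma qpi_continuous : continuous qpi. Proof. exact: pi_continuous. Qed.

Lemma qsp_continuous {Z : topologicalType} (f : qsp -> Z) :
  continuous (f \o qpi) -> continuous f.
Proof. by move=> /quotient_continuous. Qed.

(** The saturation of an open set is the union of its lattice translates. *)
Lemma qpi_open U : open U -> open (qpi @` U).
Proof.
move=> oU; rewrite /open/= /quotient_open.
rewrite (_ : _ @^-1` _ = \bigcup_(k in lat) ((fun x => x + k) @^-1` U)).
  apply: bigcup_open => k _; apply: open_comp oU => x _.
  exact: translate_continuous.
apply/seteqP; split=> x /=.
  move=> [y Uy /qpiP h]; exists (y - x) => //=.
  by rewrite addrC subrK.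
by move=> [k lk Uxk]; exists (x + k) => //; exact: qpiD.
Qed.

(** Charts are balls of radius r. The bound 4r gives uniqueness of lifts in a ball of radius 2r, and
    uniqueness of the translation between two charts, where two differences below 2r add up. *)
Definition lat_sep (r : R) := 0 < r /\ forall v, lat v -> `|v| < r *+ 4 -> v = 0.

(** If z J is small, so is z = (z J) B for a right inverse B of [J]; an integer vector with entries
    of absolute value below 1 is zero. *)
Lemma lat_sep_ex : row_free J -> exists r, lat_sep r.
Proof.
move=> fJ; pose B := pinvmx J.
pose C := \sum_k \sum_j `|B k j| + 1.
(* The sum of the absolute values of the entries of [B] bounds the growth of the sup norm under [B];
   the 1 in [C] makes the bound strict and [C] positive. *)
have S0 : 0 <= \sum_k \sum_j `|B k j| by apply: sumr_ge0 => k _; exact: sumr_ge0.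
have C0 : 0 < C by rewrite /C ltr_wpDl.
exists (C^-1 / 4); split; first by rewrite divr_gt0 ?invr_gt0.
have -> : C^-1 / 4 *+ 4 = C^-1 by rewrite -[LHS]mulr_natr divfK ?pnatr_eq0.
move=> v [z vE] vC.
suff z0 : z = 0 by rewrite vE z0 raddf0 mul0mx.
have zE : map_mx intr z = v *m B by rewrite vE mulmxKp.
apply/rowP => j; rewrite mxE.
have vk k : `|v 0 k| < C^-1.
  have : ball (0 : 'rV[R]_n) C^-1 v by rewrite -ball_normE /ball_/= sub0r normrN.
  by move=> [_ /(_ 0 k)]; rewrite /ball/= mxE sub0r normrN.
have : `|(z 0 j)%:~R : R| < 1.
  have -> : (z 0 j)%:~R = (map_mx intr z : 'rV[R]_m) 0 j by rewrite mxE.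
  rewrite zE mxE; apply: le_lt_trans (ler_norm_sum _ _ _) _.
  apply: (@le_lt_trans _ _ (C^-1 * \sum_k \sum_j `|B k j|)).
    rewrite mulr_sumr; apply: ler_sum => k _; rewrite normrM.
    apply: ler_pM => //; first exact: ltW.
    by rewrite (bigD1 j)//= lerDl; exact: sumr_ge0.
  by rewrite mulrC ltr_pdivrMr// mul1r /C ltrDl.
rewrite -intr_norm -[1]/(1%:~R) ltr_int.
by case: (z 0 j) => [[|k]|k].
Qed.

Lemma open_rV_ball (a : 'rV[R]_n) (r : R) : open (ball a r).
Proof. exact: ball_open. Qed.

(** [to] picks the lift lying in the ball, with value 0 off the domain. [inv] is the projection
    itself, so a function read in a chart is its lift to R^n. *)
Definition qchart (r : R) (a : 'rV[R]_n) : chart (R := R) qsp n :=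
  Chart (qpi @` ball a r) (fun p => xget 0 [set x | ball a r x /\ qpi x = p]) qpi.

Section Charts.
Variables (r : R) (sep : lat_sep r).
Let r0 : 0 < r := sep.1.

(** Stated at twice the chart radius, the size at which the Hausdorff property uses it. *)
Lemma lat_ball_inj a x y : ball a (r *+ 2) x -> ball a (r *+ 2) y -> lat (x - y) -> x = y.
Proof.
move=> xa ya xy; apply/eqP; rewrite -subr_eq0; apply/eqP; apply: sep.2 => //.
have /ball_sym := xa => /ball_triangle/(_ ya).
rewrite -ball_normE /ball_/= => h; apply: (lt_le_trans h).
by rewrite -mulrnDr.
Qed.

Lemma qchart_toK a x : ball a r x -> to (qchart r a) (qpi x) = x.
Proof.
move=> ax /=; case: xgetP => [y _ [ay /qpiP yx]|/(_ x)[]//].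
have r2 : r <= r *+ 2 by rewrite mulr2n lerDl ltW.
by apply: (@lat_ball_inj a) => //; apply: le_ball r2 _ _.
Qed.

Lemma qchart_img a (U : set qsp) : U `<=` Defs.dom (qchart r a) ->
  to (qchart r a) @` U = ball a r `&` qpi @^-1` U.
Proof.
move=> Ud; apply/seteqP; split=> x.
  by move=> [p Up <-]; have [y ay yp] := Ud _ Up; move: Up; rewrite -yp qchart_toK.
by move=> [ax Ux]; exists (qpi x) => //; exact: qchart_toK.
Qed.

(** Coordinate changes are locally lattice translations: their Jacobian is the identity, and
    lattice-invariant components are the same in all charts. *)
Lemma qchart_near b y : Defs.dom (qchart r b) (qpi y) ->
  exists k, lat k /\ \near y, to (qchart r b) (qpi y) = y + k.
Proof.
move=> [x bx /qpiP xy]; exists (x - y); split=> //.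
have : nbhs y ((fun z => z + (x - y)) @^-1` ball b r).
  apply: open_nbhs_nbhs; split; last by rewrite /= addrC subrK.
  apply: open_comp; last exact: open_rV_ball.
  by move=> z _; exact: translate_continuous.
apply: filterS => z bz; rewrite -(qpiD z xy).
exact: qchart_toK.
Qed.

Lemma qchart_is_chart a : is_chart (qchart r a).
Proof.
split.
- by apply: qpi_open; exact: open_rV_ball.
- by rewrite /img qchart_img// (_ : _ `&` _ = ball a r); [exact: open_rV_ball|
    apply/seteqP; split=> [x []//|x ax]; split=> //; exists x].
- by move=> _ [x ax <-]; rewrite qchart_toK.
- move=> _ [x ax <-] V; rewrite /prop_for qchart_toK// => /nbhs_ballP[e /= e0 eV].
  (* [to] is continuous because the projection is open: small balls around the lift have open
     images. *)
  have o : open (qpi @` (ball a r `&` ball x e)).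
    by apply: qpi_open; apply: openI; exact: open_rV_ball.
  have : nbhs (qpi x) (qpi @` (ball a r `&` ball x e)).
    by apply: open_nbhs_nbhs; split=> //; exists x => //; split=> //; exact: ballxx.
  by apply: filterS => _ [y [ay xy] <-]; apply: eV;
    rewrite [X in ball _ _ X](qchart_toK ay).
- by move=> x _; exact: qpi_continuous.
Qed.

Lemma translate_vsmooth_near (U : set 'rV[R]_n) (f : 'rV[R]_n -> 'rV[R]_n) :
  (forall x, U x -> exists k, \near x, f x = x + k) -> vsmooth_on U f.
Proof.
move=> fU j; apply: smooth_on_local => x /fU[k fk].
exists (fun y => y 0 j + cst (k 0 j) y); split.
  by apply: smoothD; [exact: smooth_coord|exact: smooth_cst].
by apply: filterS fk => y ->; rewrite mxE.
Qed.

Lemma qchart_compatible a b : compatible (qchart r a) (qchart r b).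
Proof.
apply: translate_vsmooth_near => _ [p [[y ay <-] bp] <-]; rewrite qchart_toK//.
by have [k [_ ?]] := qchart_near bp; exists k.
Qed.

Lemma qsp_hausdorff : hausdorff_space qsp.
Proof.
rewrite open_hausdorff => p q pq; pose x := qrepr p; pose y := qrepr q.
have nlat : ~ lat (x - y).
  by move=> /qpiP; rewrite !qreprK => /eqP; rewrite (negbTE pq).
(* At most one lattice vector lies within 2r of x - y, so x - y has positive distance [d] to the
   lattice; balls of radius d/2 around x and y then have disjoint images. *)
have [d [d0 dP]] : exists d : R, 0 < d /\ forall k, lat k -> d <= `|x - y - k|.
  have [[k0 [lk0 hk0]]|hn] := pselect (exists k, lat k /\ `|x - y - k| < r *+ 2).
    exists `|x - y - k0|; split.
      by rewrite normr_gt0 subr_eq0; apply/eqP => E; apply: nlat; rewrite E.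
    move=> k lk; rewrite leNgt; apply/negP => h.
    suff E : k = k0 by rewrite E ltxx in h.
    have B z : `|x - y - z| < r *+ 2 -> ball (x - y) (r *+ 2) z by rewrite -ball_normE.
    apply: (@lat_ball_inj (x - y)); [exact: B (lt_trans h hk0)|exact: B|].
    by apply: latD => //; exact: latN.
  exists (r *+ 2); split; first by rewrite mulrn_wgt0.
  by move=> k lk; rewrite leNgt; apply/negP => h; apply: hn; exists k.
exists (qpi @` ball x (d / 2), qpi @` ball y (d / 2)); rewrite !inE/=; split.
- by exists x; [apply: ballxx; rewrite divr_gt0|exact: qreprK].
- by exists y; [apply: ballxx; rewrite divr_gt0|exact: qreprK].
- by apply: qpi_open; exact: open_rV_ball.
- by apply: qpi_open; exact: open_rV_ball.
- apply/eqP/eqP/seteqP; split=> // _ [[u xu <-] [v yv /qpiP uv]].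
  have := dP _ (latN uv); rewrite leNgt => /negP; apply.
  move: xu yv; rewrite -!ball_normE /ball_/= => xu yv.
  rewrite [d]splitr (_ : x - y - _ = (x - u) - (y - v)); last first.
    by rewrite opprB !opprD !opprK; rewrite -!addrA; congr (_ + _); rewrite addrC -!addrA; congr (_ + _); rewrite addrC.
  by apply: (le_lt_trans (ler_normB _ _)); exact: ltrD.
Qed.

Lemma qsp_second_countable : @second_countable qsp.
Proof.
exists (range (fun qk : 'rV[rat]_n * nat => qpi @` rat_ball qk)).
  by apply: (sub_countable (card_image_le _ _)); exact: countableP.
split=> [_ [qk _ <-]|p V pV]; first by apply: qpi_open; exact: open_rV_ball.
have : nbhs (qrepr p) (qpi @^-1` V).
  by apply: qpi_continuous; rewrite qreprK.
move=> /rat_ball_basis[qk [qp qV]]; exists (qpi @` rat_ball qk).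
  by split; [exists qk|exists (qrepr p) => //; exact: qreprK].
by move=> _ [x /qV ? <-].
Qed.

(** Transparent, since its carrier, atlas and charts are used below by conversion. The chosen chart
    at a point is centred at a lift of it. *)
Definition qmanifold : manifold (R := R) n.
Proof.
refine (@Manifold R n qsp (range (qchart r)) (fun p => qchart r (qrepr p))
  qsp_hausdorff qsp_second_countable _ _ _ _).
- by move=> _ [a _ <-]; exact: qchart_is_chart.
- by move=> _ _ [a _ <-] [b _ <-]; exact: qchart_compatible.
- by move=> p; exists (qrepr p).
- by move=> p; exists (qrepr p); [exact: ballxx|exact: qreprK].
Defined.

End Charts.
End LatticeQuotient.

(** * The volume measure of the torus *)

Section QuotientMeasure.
Local Set Implicit Arguments.
Local Unset Strict Implicit.
Context {R : realType} {m : nat} {r : R} (sep : lat_sep (1%:M : 'M[R]_m) r).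
Let J : 'M[R]_m := 1%:M.
Let T : ptopologicalType := qsp J.
Let bT := g_sigma_algebraType (@open T).
Let r0 : 0 < r := sep.1.
Local Notation chart_dom a := (qpi J @` ball (a : 'rV[R]_m) r).

(** Subtracting integer parts shows that the torus is the image of the unit cube. *)
Lemma qsp_compact : compact [set: T].
Proof.
have -> : [set: T] = qpi J @` [set v : 'rV[R]_m | forall i, `[0, 1]%classic (v 0 i)].
  apply/esym; rewrite -subTset => p _; pose x := qrepr p.
  pose z : 'rV[int]_m := \row_i Num.floor (x 0 i).
  exists (x - map_mx intr z).
    move=> i /=; rewrite !mxE in_itv/=.
    have /andP[h1 h2] := floor_itv (x 0 i).
    by rewrite subr_ge0 h1/= lerBlDl -intrD1 ltW.
  rewrite -[RHS]qreprK; apply/qpiP; rewrite addrAC subrr add0r; apply: latN.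
  by exists z; rewrite mulmx1.
apply: continuous_compact; first by apply: continuous_subspaceT; exact: qpi_continuous.
apply: (@rV_compact R m (fun=> `[0, 1]%classic)) => i; exact: segment_compact.
Qed.

(** Two chart balls correspond through one lattice translation on their whole overlap, not only near
    a point: two candidates differ by less than 4r. *)
Lemma chart_shift_unique a b (x x' k k' : 'rV[R]_m) : lat J k -> lat J k' ->
  ball a r x -> ball b r (x + k) -> ball a r x' -> ball b r (x' + k') -> k = k'.
Proof.
move=> lk lk' ax bxk ax' bxk'; apply/eqP; rewrite -subr_eq0; apply/eqP.
apply: sep.2; first by apply: latD => //; exact: latN.
have /ball_triangle/(_ ax') h1 := ball_sym ax.
have /ball_triangle/(_ bxk') h2 := ball_sym bxk.
move: h1 h2; rewrite -!ball_normE /ball_/= => h1 h2.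
have -> : k - k' = (x + k - (x' + k')) - (x - x').
  by apply/rowP => j; rewrite !mxE; ring.
apply: (le_lt_trans (ler_normB _ _)); rewrite (_ : r *+ 4 = (r + r) + (r + r)).
  exact: ltrD.
by rewrite -!mulr2n -mulrnA.
Qed.

Lemma measurable_qpi : measurable_fun setT (qpi J : borel_rV m -> bT).
Proof. exact: continuous_borel_measurable (@qpi_continuous R m m J). Qed.

(** Each chart carries a multiple of Lebesgue measure on its ball. These measures agree on overlaps
    by translation invariance, and are glued along a finite cover by charts, made disjoint. *)
Lemma ex_quotient_measure (kap : R) : 0 < kap ->
  exists mu : {measure set bT -> \bar R},
   (exists2 c : R, 0 < c & mu setT = c%:E) /\
   forall a (B : set bT), measurable B -> B `<=` chart_dom a ->
     mu B = int_rV (fun x => (\1_(to (qchart J r a) @` B) x * kap)%:E).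
Proof.
move=> /(@ex_leb R m)[leb [lebE lebT lebB]].
have mball a : measurable (ball (a : 'rV[R]_m) r : set (borel_rV m)).
  by apply: open_borel_measurable; exact: open_rV_ball.
have mdom a : measurable (chart_dom a : set bT).
  by apply: open_borel_measurable; apply: qpi_open; exact: open_rV_ball.
have mpre (B : set bT) : measurable B -> measurable (qpi J @^-1` B : set (borel_rV m)).
  by move=> mB; rewrite -[X in measurable X]setTI; exact: measurable_qpi.
have ex_nu a : exists nu : {measure set bT -> \bar R},
    forall B, nu B = leb (qpi J @^-1` B `&` ball a r).
  exact: (ex_pushforward (mrestr leb (mball a)) measurable_qpi).
pose nu a := projT1 (cid (ex_nu a)).
have nuE a B : nu a B = leb (qpi J @^-1` B `&` ball a r) := projT2 (cid (ex_nu a)) B.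
(* The lifts of [B] to the two balls are translates of each other by the lattice vector [k] found at
   one point of [B]. *)
have nu_eq a b (B : set bT) : measurable B -> B `<=` chart_dom a ->
    B `<=` chart_dom b -> nu a B = nu b B.
  move=> mB Ba Bb; have [->|/set0P[p Bp]] := eqVneq B set0; first by rewrite !measure0.
  have shift x : B (qpi J x) -> exists2 k, lat J k & ball b r (x + k).
    by move=> /Bb[y by_ /qpiP yx]; exists (y - x) => //; rewrite addrC subrK.
  have [x ax xp] := Ba _ Bp; have Bx : B (qpi J x) by rewrite xp.
  have [k lk bxk] := shift _ Bx.
  rewrite !nuE -[RHS](lebT _ k); last by apply: measurableI => //; exact: mpre.
  congr (leb _); apply/seteqP; split=> y /= [By].
    move=> ay; split; first by rewrite qpiD.
    have [k' lk' byk'] := shift _ By.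
    by rewrite (chart_shift_unique lk lk' ax bxk ay byk').
  rewrite qpiD// in By; move=> byk; split=> //.
  have [z az /qpiP zy] := Ba _ By; have lz : lat J (y + k - z).
    have -> : y + k - z = k - (z - y) by apply/rowP => j; rewrite !mxE; ring.
    by apply: latD => //; exact: latN.
  have E := chart_shift_unique lk lz ax bxk az.
  have {}E : k = y + k - z by apply: E; rewrite addrC subrK.
  suff -> : y = z by [].
  apply/eqP; rewrite -subr_eq0.
  have -> : y - z = (y + k - z) - k by apply/rowP => j; rewrite !mxE; ring.
  by rewrite -E subrr.
have [D _ Dcov] : finite_subset_cover [set: 'rV[R]_m] (fun a => chart_dom a) [set: T].
  move: qsp_compact; rewrite compact_cover; apply.
    by move=> a _; apply: qpi_open; exact: open_rV_ball.
  by move=> p _; exists (qrepr p) => //; exists (qrepr p); [exact: ballxx|exact: qreprK].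
pose s : seq 'rV[R]_m := finmap.enum_fset D; pose N := size s.
pose ctr k : 'rV[R]_m := nth 0 s k.
pose F k : set bT := chart_dom (ctr k).
have mP k : measurable (seqDU F k) by apply: seqDU_measurable => i; exact: mdom.
pose mu : {measure set bT -> \bar R} :=
  msum (fun k => mrestr (nu (ctr k)) (mP k)) N.
have muE (B : set bT) : mu B = (\sum_(k < N) nu (ctr k) (B `&` seqDU F k))%E by [].
have covT : \big[setU/set0]_(k < N) seqDU F k = setT.
  rewrite -bigsetU_seqDU -subTset => p /Dcov[a /= aD ap].
  by rewrite -bigcup_mkord; exists (index a s); rewrite /= ?index_mem// /F /ctr nth_index.
(* Each piece of a set inside the chart at [a] may be measured in that chart, and the pieces add
   up. *)
have key a (B : set bT) : measurable B -> B `<=` chart_dom a -> mu B = nu a B.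
  move=> mB Ba; rewrite muE -[in RHS](setIT B) -covT -bigcup_mkord setI_bigcupr bigcup_mkord.
  transitivity (\sum_(k < N) nu a (B `&` seqDU F k))%E.
    apply: eq_bigr => k _; apply: nu_eq.
    - exact: measurableI.
    - by move=> p [_ Fp]; exact: subset_seqDU Fp.
    - by move=> p [Bp _]; exact: Ba.
  have mBP k : measurable (B `&` seqDU F k) by exact: measurableI.
  have tBP : trivIset setT (fun k => B `&` seqDU F k).
    by apply: trivIset_setIl; exact: trivIset_seqDU.
  exact/esym/(measure_bigsetU (nu a) mBP tBP N).
exists mu; split; last first.
  move=> a B mB Ba; rewrite (key a)// nuE.
  rewrite lebE; last by apply: measurableI => //; exact: mpre.
  congr int_rV; apply/funext => x; congr (\1_ _ x * _)%:E.
  by rewrite (qchart_img sep)//= setIC.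
have fin_ball a : (leb (ball a r) < +oo)%E by have [c _ ->] := lebB a r r0; rewrite ltry.
have muT_fin : (mu setT < +oo)%E.
  rewrite muE; apply: lte_sum_pinfty => k _; rewrite nuE.
  apply: (le_lt_trans _ (fin_ball (ctr k))); apply: le_measure; rewrite ?inE//.
    by apply: measurableI => //; apply: mpre; exact: measurableI.
have muT_gt : (0 < mu setT)%E.
  apply: (@lt_le_trans _ _ (mu (chart_dom 0))).
    rewrite (key 0)// nuE (_ : _ `&` _ = ball 0 r).
      by have [c c0 ->] := lebB 0 r r0; rewrite lte_fin.
    by apply/seteqP; split=> [x []//|x bx]; split=> //; exists x.
  by apply: le_measure; rewrite ?inE.
exists (fine (mu setT)); first by rewrite fine_gt0// muT_gt.
by rewrite fineK// ge0_fin_numE// ltW.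
Qed.

End QuotientMeasure.

(** * Conformal change of the second fundamental form *)

Section PositiveDefinite.
Context {R : realType}.

Definition posdef {k : nat} (A : 'M[R]_k) :=
  forall v : 'rV[R]_k, v != 0 -> 0 < (v *m A *m v^T) 0 0.

Lemma posdef_unitmx {k : nat} {A : 'M[R]_k} : posdef A -> A \in unitmx.
Proof.
move=> pA; rewrite -row_free_unit; apply: inj_row_free => v vA.
apply/eqP; apply: contraT => /pA; rewrite vA mul0mx mxE.
by rewrite ltxx.
Qed.

Lemma posdef_induced {m n : nat} (G : 'M[R]_n) (J : 'M[R]_(m, n)) :
  row_free J -> posdef G -> posdef (J *m G *m J^T).
Proof.
move=> fJ pG v v0; have -> : v *m (J *m G *m J^T) *m v^T = (v *m J) *m G *m (v *m J)^T.
  by rewrite trmx_mul !mulmxA.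
by apply: pG; apply: contraNneq v0 => vJ; apply/eqP/(row_free_inj fJ); rewrite vJ mul0mx.
Qed.

(** Acts on row vectors from the right, as the [G]-orthogonal projection onto the complement of the
    span of the rows of [J]. *)
Definition normal_proj {m n : nat} (G : 'M[R]_n) (J : 'M[R]_(m, n)) : 'M[R]_n :=
  1%:M - G *m J^T *m invmx (J *m G *m J^T) *m J.

Lemma normal_proj_tangent {m n : nat} (G : 'M[R]_n) (J : 'M[R]_(m, n)) :
  J *m G *m J^T \in unitmx -> J *m normal_proj G J = 0.
Proof.
by move=> u; rewrite mulmxBr mulmx1 !mulmxA mulmxV// mul1mx subrr.
Qed.

Lemma normal_proj_normal {m n : nat} (G : 'M[R]_n) (J : 'M[R]_(m, n)) :
  J *m G *m J^T \in unitmx -> normal_proj G J *m G *m J^T = 0.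
Proof.
move=> u; rewrite !mulmxBl mul1mx -!mulmxA [J *m (G *m J^T)]mulmxA mulVmx//.
by rewrite mulmx1 subrr.
Qed.

Lemma normal_proj_id {m n : nat} (G : 'M[R]_n) (J : 'M[R]_(m, n)) (v : 'rV[R]_n) :
  v *m G *m J^T = 0 -> v *m normal_proj G J = v.
Proof. by move=> vJ; rewrite mulmxBr mulmx1 !mulmxA vJ !mul0mx subr0. Qed.

Lemma normal_projZ {m n : nat} (s : R) (G : 'M[R]_n) (J : 'M[R]_(m, n)) :
  s != 0 -> J *m G *m J^T \in unitmx -> normal_proj (s *: G) J = normal_proj G J.
Proof.
move=> s0 u; rewrite /normal_proj -scalemxAr -!scalemxAl invmxZ ?unitfE//; last first.
  by rewrite unitmxZ ?unitfE.
by rewrite -!scalemxAr -!scalemxAl scalerA mulfV// scale1r.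
Qed.

End PositiveDefinite.

(** * The second fundamental form of an immersion and its change under rescaling of the metric *)

Section Immersion.
Context {R : realType} {m n : nat} (X : @submanifold R m n).
Hypothesis hX : riemannian_immersion X.
Variables (c : chart (R := R) (src X) m) (d : chart (R := R) (amb X) n) (p : src X).
Hypotheses (hc : atlas c) (hd : atlas d) (cp : Defs.dom c p) (dp : Defs.dom d (imm X p)).

Let q := imm X p.
Let x := to d q.
Let G := met X d q.
Let J := @jac_at R m n X c d p.
Let g := induced_metric X c d p.

Let gE : g = J *m G *m J^T. Proof. by []. Qed.

Let inv_x : Defs.inv d x = q.
Proof. by have [_ _ + _ _] := atlas_chart hd; apply. Qed.

Let img_x : img d x. Proof. by exists q. Qed.

Lemma immersion_met_sym : G^T = G.
Proof. by have [[_ + _ _] _ _ _] := hX; apply. Qed.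

Lemma immersion_met_posdef : posdef G.
Proof. by have [[_ _ + _] _ _ _] := hX; apply. Qed.

Lemma immersion_row_free : row_free J.
Proof. by have [_ _ + _] := hX; apply. Qed.

Lemma immersion_metric_unit : g \in unitmx.
Proof.
exact/posdef_unitmx/(posdef_induced _ _ immersion_row_free)/immersion_met_posdef.
Qed.

Lemma met_derivable i j e :
  derivable (fun y => met X d (Defs.inv d y) i j) x (delta_mx 0 e).
Proof.
have [[+ _ _ _] _ _ _] := hX => /(_ d hd i j 1%N)[_ /(_ e)[+ _]]; exact.
Qed.

(** The chart image is a neighbourhood of [x], so the symmetry passes to derivatives at [x]. *)
Lemma near_met_sym i j : \forall y \near x,
  met X d (Defs.inv d y) i j = met X d (Defs.inv d y) j i.
Proof.
have [_ oimg invK _ _] := atlas_chart hd.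
have : nbhs x (img d) by exact: open_nbhs_nbhs.
apply: filterS => _ [r dr <-]; rewrite invK//.
have [[_ + _ _] _ _ _] := hX => /(_ d r hd dr) E.
by rewrite -[in LHS]E mxE.
Qed.

Lemma christoffel_sym b e : christoffel d q b e = christoffel d q e b.
Proof.
apply/rowP => a; rewrite !mxE; congr (_ * _); apply: eq_bigr => k _.
congr (_ * _); rewrite [X in X - _]addrC; congr (_ - _).
exact: near_eq_derive (near_met_sym b e).
Qed.

(* The second derivative of the immersion; [h] is its normal part. *)
Let acc i j : 'rV[R]_n :=
  \row_a pderiv i (pderiv j (fun y => local_rep (imm X) c d y 0 a)) (to c p)
  + \sum_b \sum_e (J i b * J j e) *: christoffel d q b e.

Lemma second_ffE i j : second_ff c d p i j = acc i j *m normal_proj G J.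
Proof.
have E : second_ff c d p i j = acc i j - acc i j *m G *m J^T *m invmx g *m J by reflexivity.
rewrite E /normal_proj.
rewrite mulmxBr mulmx1 !mulmxA. reflexivity.
Qed.

Lemma second_ff_normal i j : second_ff c d p i j *m G *m J^T = 0.
Proof.
rewrite second_ffE -!mulmxA [normal_proj _ _ *m _]mulmxA normal_proj_normal ?mulmx0//.
exact: immersion_metric_unit.
Qed.

(** Second partial derivatives commute and the Christoffel symbols are symmetric. The torus realises
    symmetric [h], so this is what lets it copy the data of any immersion. *)
Lemma second_ff_sym i j : second_ff c d p i j = second_ff c d p j i.
Proof.
suff E : acc i j = acc j i by rewrite (second_ffE i j) E -(second_ffE j i).
have E1 : \row_a pderiv i (pderiv j (fun y => local_rep (imm X) c d y 0 a)) (to c p) =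
    \row_a pderiv j (pderiv i (fun y => local_rep (imm X) c d y 0 a)) (to c p).
  apply/rowP => a; rewrite [LHS]mxE [RHS]mxE.
  have [_ [cf sm] _ _] := hX.
  have := sm c d hc hd a 2%N => sma.
  have [_ oimg invK _ cinv] := atlas_chart hc.
  have [od _ _ _ _] := atlas_chart hd.
  refine (pderiv_comm _ _ _ _ _ _ sma).
  (* Smoothness is given on the set of coordinates of points mapped into [d]; continuity makes it a
     neighbourhood of the point. *)
  have icp : img c (to c p) by exists p.
  have n1 : nbhs (to c p) (img c) by exact: open_nbhs_nbhs.
  have n2 : nbhs (to c p) (Defs.inv c @^-1` (imm X @^-1` Defs.dom d)).
    apply: (cinv _ icp); rewrite invK//; apply: cf; exact: open_nbhs_nbhs.
  by apply: filterS2 n1 n2 => _ [r cr <-]; rewrite /= invK// => dr; exists r.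
have E2 : \sum_b \sum_e (J i b * J j e) *: christoffel d q b e =
   \sum_b \sum_e (J j b * J i e) *: christoffel d q b e.
  rewrite exchange_big/=; apply: eq_bigr => b _; apply: eq_bigr => e _.
  by rewrite (christoffel_sym e b) mulrC.
exact: (f_equal2 (fun v w : 'rV[R]_n => v + w) E1 E2).
Qed.

Section Rescale.
Variable u : amb X -> R.
Hypotheses (u0 : u q != 0)
  (du : forall e, derivable (fun y => u (Defs.inv d y)) x (delta_mx 0 e)).

Let sig e := pderiv e (fun y => u (Defs.inv d y)) x.

(** The normal part of the gradient of log u, the [W] of [rescale_pdata]. *)
Definition rescale_shift : 'rV[R]_n :=
  (u q)^-1 *: ((\row_a \sum_e invmx G a e * sig e) *m normal_proj G J).

(** The classical law for the metric u^2 G, from the product rule; [sig] divided by u is the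
    differential of log u. *)
Lemma christoffel_rescale b e :
  @christoffel R m n (rescale X u) d q b e = @christoffel R m n X d q b e +
  (u q)^-1 *: (sig e *: delta_mx 0 b + sig b *: delta_mx 0 e
     - G b e *: \row_a \sum_k invmx G a k * sig k).
Proof.
have dG i j k : pderiv k (fun y => met (rescale X u) d (Defs.inv d y) i j) x =
    u q ^+ 2 * pderiv k (fun y => met X d (Defs.inv d y) i j) x +
    2 * u q * sig k * G i j.
  have E : (fun y => met (rescale X u) d (Defs.inv d y) i j) =
      (fun y => u (Defs.inv d y)) * (fun y => u (Defs.inv d y)) *
      (fun y => met X d (Defs.inv d y) i j).
    by apply/funext => y; rewrite /= mxE expr2.
  rewrite /pderiv E deriveM; [|exact: derivableM|exact: met_derivable].
  rewrite deriveM; [|exact: du|exact: du].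
  rewrite /= -![(_ * _ : _ -> _) _]/(_ * _) inv_x -/(pderiv _ _ _) -/(sig k) -/G.
  rewrite /GRing.scale/=.
  rewrite -![derive (fun y => u (Defs.inv d y)) x _]/(sig k).
  move: (sig k) (pderiv k (fun y => met X d (Defs.inv d y) i j) x) => s t.
  by ring.
have invG a e' : \sum_k invmx G a k * G e' k = (a == e')%:R.
  have <- : (1%:M : 'M[R]_n) a e' = (a == e')%:R by rewrite mxE.
  rewrite -(mulVmx (posdef_unitmx immersion_met_posdef)) mxE.
  apply: eq_bigr => k _; congr (_ * _).
  by rewrite -[in LHS]immersion_met_sym mxE.
have uG : G \in unitmx := posdef_unitmx immersion_met_posdef.
have u2 : u q ^+ 2 \is a GRing.unit by rewrite unitfE expf_neq0.
apply/rowP => a; rewrite [LHS]mxE [RHS]mxE [X in _ = X + _]mxE.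
have -> : ((u q)^-1 *: (sig e *: delta_mx 0 b + sig b *: delta_mx 0 e
     - G b e *: \row_a \sum_k invmx G a k * sig k)) 0 a =
   (u q)^-1 * (sig e * (a == b)%:R + sig b * (a == e)%:R
     - G b e * \sum_k invmx G a k * sig k).
  by rewrite !mxE eqxx.
rewrite -!invG.
under eq_bigr => k _.
  rewrite !dG (_ : met (rescale X u) d q = u q ^+ 2 *: G)// invmxZ ?unitmxZ// mxE.
  rewrite (_ : _ * _ = invmx G a k * (pderiv b (fun y => met X d (Defs.inv d y) e k) x +
     pderiv e (fun y => met X d (Defs.inv d y) b k) x -
     pderiv k (fun y => met X d (Defs.inv d y) b e) x) +
     2 * (u q)^-1 * (sig b * (invmx G a k * G e k) + sig e * (invmx G a k * G b k)
       - G b e * (invmx G a k * sig k))); last first.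
    move: (pderiv b _ _) (pderiv e _ _) (pderiv k _ _) => A B D.
    by move: (sig b) (sig e) (sig k) => sb se sk; field.
  over.
rewrite big_split/= mulrDr; congr (_ + _).
rewrite -mulr_sumr !mulrA mulVf ?pnatr_eq0// mul1r; congr (_ * _).
rewrite big_split/= sumrN big_split/= -!mulr_sumr; congr (_ - _).
by rewrite addrC.
Qed.

(** After contraction with [J] the two Kronecker terms of the Christoffel change are multiples of
    rows of [J], which the normal projection kills; the gradient term survives with coefficient
    [g i j]. *)
Lemma second_ff_rescale i j :
  @second_ff R m n (rescale X u) c d p i j =
  @second_ff R m n X c d p i j - g i j *: rescale_shift.
Proof.
pose grad : 'rV[R]_n := \row_a \sum_k invmx G a k * sig k.
pose acc' := \row_a pderiv i (pderiv j (fun y => local_rep (imm X) c d y 0 a)) (to c p)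
  + \sum_b \sum_e (J i b * J j e) *: @christoffel R m n (rescale X u) d q b e.
have u2 : u q ^+ 2 != 0 by rewrite expf_neq0.
have E : @second_ff R m n (rescale X u) c d p i j =
   acc' - acc' *m (u q ^+ 2 *: G) *m J^T *m invmx (J *m (u q ^+ 2 *: G) *m J^T) *m J.
  by reflexivity.
have E' : acc' = acc i j + (u q)^-1 *: ((\sum_e J j e * sig e) *: row i J
    + (\sum_b J i b * sig b) *: row j J - g i j *: grad).
  rewrite /acc' /acc -[RHS]addrA; apply: (f_equal (fun v => _ + v)).
  under eq_bigr do under eq_bigr do rewrite christoffel_rescale scalerDr.
  under eq_bigr do rewrite big_split/=.
  rewrite big_split/=; congr (_ + _).
  have row_sum k : row k J = \sum_b J k b *: delta_mx 0 b.
    by rewrite [LHS]row_sum_delta; apply: eq_bigr => b _; rewrite mxE.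
  have gij : g i j = \sum_b \sum_e J i b * G b e * J j e.
    rewrite gE mxE exchange_big/=; apply: eq_bigr => e _.
    by rewrite mxE mulr_suml; apply: eq_bigr => b _; rewrite [J^T _ _]mxE.
  have term b e : (J i b * J j e) *: ((u q)^-1 *:
      (sig e *: delta_mx 0 b + sig b *: delta_mx 0 e - G b e *: grad)) =
    (u q)^-1 *: ((J j e * sig e) *: (J i b *: delta_mx 0 b)
      + (J i b * sig b) *: (J j e *: delta_mx 0 e)
      - (J i b * G b e * J j e) *: grad) :> 'rV[R]_n.
    move: (J i b) (J j e) (sig e) (sig b) (G b e) grad (u q)^-1 => s1 s2 s3 s4 s5 v s6.
    rewrite [LHS]scalerA mulrC -[LHS]scalerA; congr (_ *: _).
    by rewrite scalerBr scalerDr !scalerA; congr (_ *: _ + _ *: _ - _ *: _); ring.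
  under eq_bigr do under eq_bigr do rewrite term.
  under eq_bigr do rewrite -scaler_sumr sumrB big_split/=.
  rewrite -scaler_sumr sumrB big_split/=; congr (_ *: (_ + _ - _)).
  - rewrite row_sum scaler_sumr; apply: eq_bigr => b _.
    by rewrite -scaler_suml.
  - rewrite exchange_big/= row_sum scaler_sumr; apply: eq_bigr => e _.
    by rewrite -scaler_suml.
  - rewrite gij scaler_suml; apply: eq_bigr => b _.
    by rewrite -scaler_suml.
have NPJ k : row k J *m normal_proj G J = 0.
  by rewrite -row_mul normal_proj_tangent ?immersion_metric_unit// row0.
have {}E : @second_ff R m n (rescale X u) c d p i j = acc' *m normal_proj G J.
  rewrite E -(normal_projZ _ _ _ u2 immersion_metric_unit) /normal_proj.
  by rewrite mulmxBr mulmx1 !mulmxA.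
rewrite E (second_ffE i j) E' mulmxDl; congr (_ + _).
rewrite -scalemxAl mulmxBl mulmxDl -!scalemxAl !NPJ !scaler0 addr0 sub0r.
by rewrite /rescale_shift scalerN; congr (- _); rewrite [LHS]scalerA [RHS]scalerA mulrC.
Qed.
End Rescale.
End Immersion.

(** * The data of an immersion at a point *)

Section GeometricData.
Context {R : realType} {m n : nat}.
Implicit Types (X : @submanifold R m n) (T : @pdata R m n).

(** The algebraic conditions met by the data of an immersion with differential [J]. They are also
    sufficient: [regular_realized] attains all such data. *)
Record regular_pdata (T : @pdata R m n) (J : 'M[R]_(m, n)) : Prop := RegularPdata {
  reg_pg : pg T = J *m pG T *m J^T;
  reg_sym : (pG T)^T = pG T;
  reg_pos : posdef (pG T);
  reg_free : row_free J;
  reg_normal : forall i j, ph T i j *m pG T *m J^T = 0;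
  reg_phC : forall i j, ph T i j = ph T j i;
  reg_nu : n = m.+1 -> J *m pG T *m (pnu T)^T = 0 /\ (pnu T *m pG T *m (pnu T)^T) 0 0 = 1 }.

Lemma regular_unitmx T J : regular_pdata T J -> pg T \in unitmx.
Proof.
move=> [-> _ pos free _ _ _]; exact: posdef_unitmx (posdef_induced _ _ free pos).
Qed.

Lemma regular_pg_sym T J : regular_pdata T J -> (pg T)^T = pg T.
Proof. by move=> [-> sG _ _ _ _ _]; rewrite !trmx_mul trmxK sG mulmxA. Qed.

Lemma geom_regular X (p : src X) : riemannian_immersion X ->
  regular_pdata (geom X p) (jac_at (chart_at p) (chart_at (imm X p)) p).
Proof.
move=> hX; set c := chart_at p; set d := chart_at (imm X p).
have hc : atlas c := chart_at_atlas p.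
have hd : atlas d := chart_at_atlas (imm X p).
have cp : Defs.dom c p := chart_at_dom p.
have dp : Defs.dom d (imm X p) := chart_at_dom (imm X p).
split.
- by [].
- exact: immersion_met_sym hX _ _ hd dp.
- exact: immersion_met_posdef hX _ _ hd dp.
- exact: immersion_row_free hX _ _ _ hc hd cp dp.
- move=> i j; exact: second_ff_normal hX _ _ _ hc hd cp dp i j.
- move=> i j; exact: second_ff_sym hX _ _ _ hc hd cp dp i j.
- have [_ _ _ +] := hX => /[apply] -[_ h1 h2 _]; split; first exact: h1.
  exact: h2.
Qed.

Lemma geom_rescale X (p : src X) (u : amb X -> R) : riemannian_immersion X ->
  let d := chart_at (imm X p) in u (imm X p) != 0 ->
  (forall e, derivable (fun y => u (Defs.inv d y)) (to d (imm X p)) (delta_mx 0 e)) ->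
  geom (rescale X u) p = rescale_pdata (u (imm X p))
     (rescale_shift X (chart_at p) d p u) (geom X p).
Proof.
move=> hX d u0 du; rewrite /rescale_pdata; congr PData.
- by rewrite /induced_metric /= -scalemxAr -scalemxAl.
- apply/funext => i; apply/funext => j.
  exact: (second_ff_rescale X hX _ _ _ (chart_at_atlas p) (chart_at_atlas _)
    (chart_at_dom p) (chart_at_dom _)).
Qed.

Lemma geom_homothety X (p : src X) (t : R) : riemannian_immersion X -> 0 < t ->
  geom (homothety X t) p = rescale_pdata t 0 (geom X p).
Proof.
move=> hX t0; rewrite /homothety geom_rescale ?gt_eqF//; congr rescale_pdata.
rewrite /rescale_shift (_ : \row_a _ = 0) ?mul0mx ?scaler0//.
apply/rowP => a; rewrite !mxE big1// => k _.
by rewrite /pderiv derive_cst mulr0.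
Qed.

Lemma geom_conformal X (p : src X) (phi : amb X -> R) : riemannian_immersion X ->
  smooth_fun phi -> geom (conformal X phi) p = rescale_pdata (expR (phi (imm X p)))
   (rescale_shift X (chart_at p) (chart_at (imm X p)) p (fun q => expR (phi q))) (geom X p).
Proof.
move=> hX sphi; apply: geom_rescale => //; first by rewrite gt_eqF ?expR_gt0.
move=> e; have [_ /(_ e)[dphi _]] := sphi _ (chart_at_atlas (imm X p)) 1%N.
have := derivableP (dphi _ (ex_intro2 _ _ _ (chart_at_dom (imm X p)) erefl)).
by move=> /is_derive_expR_comp[].
Qed.

End GeometricData.

(** * Affine maps *)

Section Determinant.
Context {R : realType}.

(* [det ((1 - t) + t A)] has no root in [0, 1] and equals 1 at 0. *)
Lemma posdef_det_gt0 {k : nat} (A : 'M[R]_k) : posdef A -> 0 < \det A.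
Proof.
move=> pA.
pose P : {poly R} := \det (map_mx polyC 1%:M + 'X *: map_mx polyC (A - 1%:M)).
have PE t : P.[t] = \det (1%:M + t *: (A - 1%:M)).
  rewrite -/(horner_eval t P) -det_map_mx; congr (\det _); apply/matrixP => i j.
  rewrite !mxE -[LHS]/((((i == j)%:R)%:P + 'X * (A i j - (i == j)%:R)%:P).[t]).
  by rewrite hornerD hornerM hornerX !hornerC.
rewrite ltNge; apply/negP => detA.
have [|t /andP[t0 t1] /rootP] := @poly_ivt R (- P) 0 1 ler01.
  rewrite !hornerN !PE scale0r addr0 det1 scale1r [_ + (_ - _)]addrC subrK.
  by rewrite oppr_le0 ler01 oppr_ge0.
rewrite hornerN PE => /eqP; rewrite oppr_eq0; apply/negP.
rewrite -unitfE -/(unitmx _); apply: posdef_unitmx => v v0.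
have -> : v *m (1%:M + t *: (A - 1%:M)) *m v^T =
    (1 - t) *: (v *m v^T) + t *: (v *m A *m v^T).
  rewrite mulmxDr mulmx1 -scalemxAr mulmxBr mulmx1 mulmxDl -scalemxAl mulmxBl.
  by rewrite scalerBr scalerBl scale1r addrAC addrA.
have vv : 0 < (v *m v^T) 0 0.
  have [k0 vk] : exists k0, v 0 k0 != 0 by exact/rV0Pn.
  rewrite mxE (bigD1 k0)//= ltr_pwDl//.
    by rewrite mxE -expr2 exprn_even_gt0.
  by apply: sumr_ge0 => l _; rewrite mxE -expr2 sqr_ge0.
have vAv := pA _ v0.
rewrite [X in 0 < X]mxE [X in 0 < X + _]mxE [X in 0 < _ + X]mxE.
have [->|tn0] := eqVneq t 0; first by rewrite subr0 mul1r mul0r addr0.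
rewrite ltr_wpDl//; first by rewrite mulr_ge0 ?subr_ge0// ltW.
by rewrite mulr_gt0// lt_def tn0.
Qed.
End Determinant.

Section AffineMaps.
Context {R : realType} {m n : nat} (A : 'M[R]_(m, n)).

Lemma mulmx_continuous : continuous (fun x : 'rV[R]_m => x *m A).
Proof.
move=> x V /nbhs_ballP[e /= e0 eV].
have H j : \forall y \near x, ball ((x *m A) 0 j) e ((y *m A) 0 j).
  have [+ _] := mx_smoothM _ _ mx_smooth_id (mx_smooth_cst A) 0 j 0%N.
  by move=> /(_ x I); apply; exact: nbhsx_ballx.
have := @filter_forall _ _ _ _ (nbhs_filter x) H; apply: filterS => y Hy; apply: eV; split=> // i j.
by rewrite (ord1 i); exact: Hy.
Qed.

Lemma affine_pderiv (f : 'rV[R]_m -> 'rV[R]_n) (k : 'rV[R]_n) x i j :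
  (\near x, f x = x *m A + k) -> pderiv i (fun y => f y 0 j) x = A i j.
Proof.
move=> fE; rewrite /pderiv (near_eq_derive (g := fun y => (y *m A + k) 0 j)).
  have H : is_derive x (delta_mx 0 i) (fun y : 'rV[R]_m => (y *m A + k) 0 j) (A i j).
    apply: (is_derive_quadratic _ _ _ _ 0) => h.
    by rewrite mulmxDl -scalemxAl -rowE !mxE mulr0 addr0; ring.
  by case: H.
by apply: filterS fE => y ->.
Qed.

Lemma affine_jac (f : 'rV[R]_m -> 'rV[R]_n) (k : 'rV[R]_n) x :
  (\near x, f x = x *m A + k) -> jac f x = A.
Proof. by move=> fE; apply/matrixP => i j; rewrite mxE; exact: affine_pderiv fE. Qed.

Lemma affine_pderiv2 (f : 'rV[R]_m -> 'rV[R]_n) (k : 'rV[R]_n) x i j a :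
  (\near x, f x = x *m A + k) -> pderiv i (pderiv j (fun y => f y 0 a)) x = 0.
Proof.
move=> /nbhs_interior fE; rewrite /pderiv (near_eq_derive (g := cst (A j a))).
  by rewrite derive_cst.
by apply: filterS fE => y fy; exact: affine_pderiv fy.
Qed.

(** Only the linear part is common to all points; the translation may change with the lift. *)
Lemma affine_vsmooth (f : 'rV[R]_m -> 'rV[R]_n) U :
  (forall x, U x -> exists k : 'rV[R]_n, \near x, f x = x *m A + k) -> vsmooth_on U f.
Proof.
move=> fU j; apply: smooth_on_local => x /fU[k fk].
exists (fun y => (y *m A + cst k y) 0 j); split; last by apply: filterS fk => y ->.
apply: mx_smoothD; last exact: mx_smooth_cst.
exact: mx_smoothM mx_smooth_id (mx_smooth_cst A).
Qed.

End AffineMaps.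

(** * The immersed torus with prescribed second fundamental form *)

Section Model.
Context {R : realType} {m n : nat}.
Variables (T : @pdata R m n) (J : 'M[R]_(m, n)).
Hypothesis reg : regular_pdata T J.
Variables (rM rN : R).
Hypotheses (sepM : lat_sep (1%:M : 'M[R]_m) rM) (sepN : lat_sep J rN).

Let g := pg T.
Let G := pG T.
Let h := ph T.
Let gE : g = J *m G *m J^T := reg_pg _ _ reg.
Let gU : g \in unitmx := regular_unitmx _ _ reg.
Let gS : g^T = g := regular_pg_sym _ _ reg.
Let GS : G^T = G := reg_sym _ _ reg.
Let GP : posdef G := reg_pos _ _ reg.
Let gP : posdef g.
Proof. by rewrite gE; exact: posdef_induced (reg_free _ _ reg) GP. Qed.

(** A right inverse of [J]: v S are the coordinates, in the rows of [J], of the tangential part of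
    v. *)
Let S : 'M[R]_(n, m) := G *m J^T *m invmx g.

Let JS : J *m S = 1%:M. Proof. by rewrite /S !mulmxA -gE mulmxV. Qed.

(** The pairing of [h] with the position z. As [h] is normal it vanishes on the span of the rows of
    [J], so the metric built from it is lattice-invariant and constant along the torus. *)
Definition model_B (z : 'rV[R]_n) : 'M[R]_m :=
  \matrix_(i, j) (h i j *m G *m z^T) 0 0.

(* Differs from [G] by a term linear in [model_B z], which prescribes [h], and a
   quadratic one, which only keeps the metric positive definite. *)
Definition model_G (z : 'rV[R]_n) : 'M[R]_n :=
  G + (- 2) *: (S *m model_B z *m S^T)
    + 2 *: (S *m model_B z *m invmx g *m model_B z *m S^T).

Lemma model_BE z i j : model_B z i j = (h i j *m G *m z^T) 0 0.
Proof. by rewrite mxE. Qed.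

Lemma model_B_sym z : (model_B z)^T = model_B z.
Proof. by apply/matrixP => i j; rewrite !mxE /h (reg_phC _ _ reg). Qed.

Lemma model_BD z w : model_B (z + w) = model_B z + model_B w.
Proof.
apply/matrixP => i j; rewrite [RHS]mxE !model_BE.
by rewrite [(z + w)^T]raddfD/= mulmxDr mxE.
Qed.

Lemma model_BZ (t : R) z : model_B (t *: z) = t *: model_B z.
Proof.
apply/matrixP => i j; rewrite [RHS]mxE !model_BE.
by rewrite [(t *: z)^T]linearZ/= -scalemxAr mxE.
Qed.

Lemma model_BJ y : model_B (y *m J) = 0.
Proof.
apply/matrixP => i j; rewrite model_BE trmx_mul mulmxA.
by rewrite (reg_normal _ _ reg) mul0mx !mxE.
Qed.

Lemma model_GD z k : lat J k -> model_G (z + k) = model_G z.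
Proof. by move=> [t ->]; rewrite /model_G model_BD model_BJ addr0. Qed.

Lemma model_GJ y : model_G (y *m J) = G.
Proof. by rewrite /model_G model_BJ !(mulmx0, mul0mx) !scaler0 !addr0. Qed.

Lemma model_G_smooth : mx_smooth model_G.
Proof.
have sB : mx_smooth model_B.
  move=> i j; under eq_fun do rewrite mxE.
  apply: (@mx_smoothM _ _ _ _ _ (fun=> h i j *m G)); first exact: mx_smooth_cst.
  exact: mx_smooth_tr mx_smooth_id.
have c p q (A : 'M[R]_(p, q)) := @mx_smooth_cst R n _ _ A.
apply: mx_smoothD; first apply: mx_smoothD; first exact: c.
  apply: mx_smoothZ; apply: mx_smoothM (c _ _ _).
  exact: mx_smoothM (c _ _ _) sB.
apply: mx_smoothZ; apply: mx_smoothM (c _ _ _); apply: (mx_smoothM _ _ _ sB).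
apply: mx_smoothM (c _ _ _); exact: mx_smoothM (c _ _ _) sB.
Qed.

Lemma model_G_sym z : (model_G z)^T = model_G z.
Proof.
rewrite /model_G !raddfD/= !linearZ/= !trmx_mul !trmxK model_B_sym GS.
by rewrite trmx_inv gS !mulmxA.
Qed.

(** Completing squares: with w the tangential coordinates of v and u = w B g^-1, the form is that of
    [G] on v - w J plus those of [g] on w - u and on u. If all three vanish, so does v. *)
Lemma model_G_posdef z : posdef (model_G z).
Proof.
move=> v v0; pose w := v *m S; pose u := w *m model_B z *m invmx g.
have wg : w *m g = v *m G *m J^T by rewrite /w /S !mulmxA mulmxKV.
have gw : g *m w^T = J *m G *m v^T.
  by rewrite -[g]gS -trmx_mul wg !trmx_mul trmxK GS mulmxA.
have ug : u *m g = w *m model_B z by rewrite /u mulmxKV.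
have gu : g *m u^T = model_B z *m w^T.
  by rewrite -[g]gS -trmx_mul ug trmx_mul model_B_sym.
have E : v *m model_G z *m v^T = (v - w *m J) *m G *m (v - w *m J)^T +
    ((w - u) *m g *m (w - u)^T + u *m g *m u^T).
  have E1 : (v - w *m J) *m G *m (v - w *m J)^T = v *m G *m v^T - w *m g *m w^T.
    rewrite [(v - _)^T]raddfB/= trmx_mul !mulmxBl !mulmxBr.
    rewrite -[w *m J *m G *m v^T]mulmxA -[w *m J *m _]mulmxA [J *m (G *m _)]mulmxA -gw.
    rewrite [v *m G *m (J^T *m _)]mulmxA -wg.
    rewrite [w *m J *m G *m (J^T *m _)]mulmxA -[w *m J *m G]mulmxA -[w *m (J *m G) *m _]mulmxA -gE.
    by rewrite mulmxA subrr subr0.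
  have E2 : (w - u) *m g *m (w - u)^T = w *m g *m w^T
      - 2 *: (w *m model_B z *m w^T) + u *m g *m u^T.
    rewrite [(w - u)^T]raddfB/= !mulmxBl !mulmxBr ug.
    rewrite -[w *m g *m u^T]mulmxA gu mulmxA.
    by rewrite scaler_nat mulr2n opprB opprD !addrA addrAC.
  have E3 : u *m g *m u^T = w *m model_B z *m invmx g *m model_B z *m w^T.
    by rewrite -mulmxA gu mulmxA.
  have wE : w^T = S^T *m v^T by rewrite trmx_mul.
  rewrite E1 E2 E3 wE /w /model_G !mulmxDr !mulmxDl -!scalemxAr -!scalemxAl !mulmxA.
  set a := v *m G *m v^T; set b := _ *m invmx g *m _ *m _ *m _.
  rewrite scaleNr !scaler_nat !mulr2n.
  by apply/matrixP => i j; rewrite !mxE; ring.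
have mxD (A A' : 'M[R]_1) : (A + A') 0 0 = A 0 0 + A' 0 0 by rewrite mxE.
rewrite E !mxD; have [u0|u0] := eqVneq u 0; last first.
  rewrite ltr_wpDl ?ltr_wpDl//.
  - have [->|h1] := eqVneq (v - w *m J) 0; first by rewrite !mul0mx mxE.
    exact/ltW/GP.
  - have [->|h1] := eqVneq (w - u) 0; first by rewrite !mul0mx mxE.
    exact/ltW/gP.
  - exact: gP.
rewrite u0 subr0 !mul0mx [X in _ + (_ + X)]mxE addr0.
have [w0|w0] := eqVneq w 0.
  rewrite w0 !mul0mx subr0 [X in _ + X]mxE addr0; exact: GP.
rewrite ltr_wpDl//; last exact: gP.
have [->|h1] := eqVneq (v - w *m J) 0; first by rewrite !mul0mx mxE.
exact/ltW/GP.
Qed.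

(** Where [model_B] vanishes, as on the torus, the quadratic term is of second order. *)
Lemma model_G_pderiv e b k z : model_B z = 0 ->
  pderiv k (fun y => model_G y b e) z = (- 2) * (S *m model_B (delta_mx 0 k) *m S^T) b e.
Proof.
move=> Bz; rewrite /pderiv.
have H : is_derive z (delta_mx 0 k) (fun y => model_G y b e)
    ((- 2) * (S *m model_B (delta_mx 0 k) *m S^T) b e).
  apply: (is_derive_quadratic _ _ _ _
    (2 * (S *m model_B (delta_mx 0 k) *m invmx g *m model_B (delta_mx 0 k) *m S^T) b e)).
  move=> t; rewrite /model_G model_BD Bz model_BZ addr0.
  rewrite !(mulmx0, mul0mx) -!(scalemxAr, scalemxAl) !scaler0 !addr0.
  by rewrite !mxE; ring.
by case: H.
Qed.

(** * The immersed torus and its geometric data *)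

Definition model_M : manifold (R := R) m := qmanifold sepM.
Definition model_N : manifold (R := R) n := qmanifold sepN.
Definition model_f (p : model_M) : model_N := qpi J (qrepr (p : qsp 1%:M) *m J).
(** The metric has the same components in all charts, coordinate changes being translations. A
    constant vector can be the unit normal because the metric is constant along the torus. *)
Definition model_X : @submanifold R m n :=
  @Submanifold R m n model_N model_M model_f
    (fun _ q => model_G (qrepr (q : qsp J))) (fun _ _ => pnu T).

Lemma model_f_qpi x : model_f (qpi 1%:M x) = qpi J (x *m J).
Proof.
apply/qpiP; have [z zE] : lat 1%:M (qrepr (qpi (1%:M : 'M[R]_m) x) - x).
  by apply/qpiP; rewrite qreprK.
by exists z; rewrite -mulmxBl zE mulmx1.
Qed.

Lemma model_met_qpi d z : met model_X d (qpi J z) = model_G z.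
Proof.
have : lat J (qrepr (qpi J z) - z) by apply/qpiP; rewrite qreprK.
by move=> /(model_GD z) <-; rewrite addrC subrK.
Qed.

Lemma model_local_rep c d x : @atlas R m model_M c -> @atlas R n model_N d ->
  Defs.dom d (model_f (Defs.inv c x)) ->
  exists k, lat J k /\ \near x, local_rep model_f c d x = x *m J + k.
Proof.
move=> [a _ <-] [b _ <-]; rewrite [Defs.inv _ x]/(qpi 1%:M x) model_f_qpi.
move=> /(qchart_near sepN)[k [lk near_k]]; exists k; split=> //.
have {}near_k : nbhs x ((fun y => y *m J) @^-1`
    [set y | to (qchart J rN b) (qpi J y) = y + k]) := mulmx_continuous J x _ near_k.
apply: filterS near_k => y /= yk.
by rewrite -yk /local_rep /= model_f_qpi.
Qed.

Lemma model_transition d e q : @atlas R n model_N d -> @atlas R n model_N e ->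
  Defs.dom d q -> Defs.dom e q -> jac (transition d e) (to d q) = 1%:M.
Proof.
move=> [a _ <-] [b _ <-] [x ax <-]; rewrite (qchart_toK sepN)// => bx.
have [k [_ near_k]] := qchart_near sepN bx.
apply: (@affine_jac _ _ _ _ _ k); apply: filterS near_k => y yk.
by rewrite mulmx1 -yk.
Qed.

Lemma model_jac c d p : @atlas R m model_M c -> @atlas R n model_N d ->
  Defs.dom c p -> Defs.dom d (model_f p) ->
  exists k, lat J k /\ \forall y \near to c p, local_rep model_f c d y = y *m J + k.
Proof.
move=> hc hd cp dp; apply: model_local_rep => //.
by have [_ _ invK _ _] := atlas_chart hc; rewrite (invK p cp).
Qed.

Lemma model_f_continuous : continuous model_f.
Proof.
apply: qsp_continuous => x.
rewrite (_ : _ \o _ = fun x : 'rV[R]_m => qpi J (x *m J)); last first.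
  by apply/funext => y; exact: model_f_qpi.
apply: (@continuous_comp _ _ _ (fun y : 'rV[R]_m => y *m J)).
  exact: mulmx_continuous.
exact: qpi_continuous.
Qed.

Lemma model_jac_at c d (p : src model_X) : @atlas R m model_M c ->
  @atlas R n model_N d -> Defs.dom c p -> Defs.dom d (model_f p) ->
  @jac_at R m n model_X c d p = J.
Proof.
move=> hc hd cp dp; have [k [_ near_k]] := @model_jac c d p hc hd cp dp.
exact: affine_jac near_k.
Qed.

Lemma model_met_f d (p : model_M) : met model_X d (model_f p) = G.
Proof. by rewrite /model_f model_met_qpi model_GJ. Qed.

Lemma model_immersion : riemannian_immersion model_X.
Proof.
have hjac := @model_jac_at; have metf := model_met_f.
split.
- split.
  + move=> c hc i j; have [a _ <-] := hc.
    rewrite (_ : (fun x => _) = fun x => model_G x i j).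
      by apply: smooth_on_sub; exact: model_G_smooth.
    by apply/funext => x; rewrite model_met_qpi.
  + by move=> c q _ _; exact: model_G_sym.
  + by move=> c q _ _ v; exact: model_G_posdef.
  + by move=> c d q hc hd cq dq; rewrite /= model_transition// trmx1 mulmx1 mul1mx.
- split; first exact: model_f_continuous.
  move=> c d hc hd; apply: affine_vsmooth => _ [p [cp dp] <-].
  have [k [_ near_k]] := @model_jac c d p hc hd cp dp; exists k; exact: near_k.
- move=> c d p hc hd cp dp; rewrite hjac//; exact: reg_free _ _ reg.
- move=> nm; have [nu1 nu2] := reg_nu _ _ reg nm; split.
  + by move=> d e p hd he dp ep; rewrite model_transition// mulmx1.
  + by move=> c d p hc hd cp dp; rewrite hjac// metf.
  + by move=> d p hd dp; rewrite metf.
  + by move=> _ d p _ _; exact: cst_continuous.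
Qed.

Lemma model_inv d q : @atlas R n model_N d -> Defs.dom d q -> qpi J (to d q) = q.
Proof. by move=> [b _ <-] [y by_ <-]; rewrite (qchart_toK sepN). Qed.

Lemma model_B_to d (p : model_M) : @atlas R n model_N d -> Defs.dom d (model_f p) ->
  model_B (to d (model_f p)) = 0.
Proof.
move=> hd dp; have /qpiP[z] := model_inv _ _ hd dp.
move=> /(canRL (subrK _)) ->; by rewrite -mulmxDl model_BJ.
Qed.

Lemma model_B_row i : \sum_b J i b *: model_B (delta_mx 0 b) = 0.
Proof.
have B0 : model_B 0 = 0 by rewrite -(mul0mx _ J) model_BJ.
transitivity (model_B (row i J)); last by rewrite rowE model_BJ.
rewrite [row i J]row_sum_delta (big_morph model_B model_BD B0); apply: eq_bigr => b _.
by rewrite model_BZ mxE.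
Qed.

(** The factor 1/2 of the Christoffel symbols meets the -2 of [model_G]. *)
Lemma model_christoffel d (p : model_M) b e a : @atlas R n model_N d ->
  Defs.dom d (model_f p) ->
  let D k b e := (S *m model_B (delta_mx 0 k) *m S^T) b e in
  @christoffel R m n model_X d (model_f p) b e 0 a =
  \sum_k invmx G a k * (D k b e - D b e k - D e b k).
Proof.
move=> hd dp D; rewrite [LHS]mxE model_met_f mulr_sumr; apply: eq_bigr => k _.
have Bx := model_B_to _ _ hd dp; have [b0 _ dE] := hd.
have metE i j : (fun y => met model_X d (Defs.inv d y) i j) = fun y => model_G y i j.
  by apply/funext => y; rewrite -dE model_met_qpi.
rewrite !metE !model_G_pderiv// -!/(D _ _ _); move: (D _ _ _) (D _ _ _) (D _ _ _) => s t w.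
by field.
Qed.

(** Contracted with two tangent vectors, the Christoffel terms that differentiate along the torus
    vanish; the remaining one is [h i j] with its index lowered by [G]. *)
Lemma model_acceleration d (p : model_M) i j : @atlas R n model_N d ->
  Defs.dom d (model_f p) ->
  \sum_b \sum_e (J i b * J j e) *: @christoffel R m n model_X d (model_f p) b e = h i j.
Proof.
move=> hd dp; apply/rowP => a; pose D k b e := (S *m model_B (delta_mx 0 k) *m S^T) b e.
transitivity (\sum_b \sum_e \sum_k J i b * J j e * (invmx G a k * (D k b e - D b e k - D e b k))).
  rewrite summxE; apply: eq_bigr => b _; rewrite summxE; apply: eq_bigr => e _.
  by rewrite mxE model_christoffel// mulr_sumr.
(* The derivative of the metric along a row of [J] is zero. *)
have D0 i0 e k : \sum_b J i0 b * D b e k = 0.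
  have := congr1 (fun A => (S *m A *m S^T) e k) (model_B_row i0).
  rewrite mulmx0 mul0mx [RHS]mxE => E0; rewrite -[RHS]E0 mulmx_sumr mulmx_suml summxE.
  by apply: eq_bigr => b _; rewrite -scalemxAr -scalemxAl mxE.
(* [J] cancels [S] on both sides, which leaves [model_B] in the direction k. *)
have D1 k : \sum_b \sum_e J i b * J j e * D k b e = (h i j *m G) 0 k.
  transitivity ((J *m (S *m model_B (delta_mx 0 k) *m S^T) *m J^T) i j).
    rewrite mxE exchange_big/=; apply: eq_bigr => e _; rewrite mxE mulr_suml.
    by apply: eq_bigr => b _; rewrite [J^T _ _]mxE mulrAC.
  have H (A : 'M[R]_(n, m)) B : J *m A = 1%:M -> J *m (A *m B *m A^T) *m J^T = B.
    by move=> JA; rewrite !mulmxA JA mul1mx -mulmxA -trmx_mul JA trmx1 mulmx1.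
  by rewrite (H _ _ JS) model_BE trmx_delta -colE mxE.
transitivity (\sum_k invmx G a k * (\sum_b \sum_e J i b * J j e * D k b e
   - \sum_e J j e * (\sum_b J i b * D b e k) - \sum_b J i b * (\sum_e J j e * D e b k))).
  under eq_bigr do rewrite exchange_big/=.
  rewrite exchange_big/=; apply: eq_bigr => k _.
  under [X in _ - X - _]eq_bigr do rewrite mulr_sumr.
  rewrite [X in _ - X - _]exchange_big/= -!sumrB mulr_sumr; apply: eq_bigr => b _.
  rewrite mulr_sumr -!sumrB mulr_sumr; apply: eq_bigr => e _.
  by ring.
transitivity ((h i j *m G *m (invmx G)^T) 0 a).
  rewrite mxE; apply: eq_bigr => k _; rewrite D1.
  under eq_bigr do rewrite D0 mulr0; under [X in _ - X]eq_bigr do rewrite D0 mulr0.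
  by rewrite !big1_eq !subr0 mulrC [(invmx G)^T _ _]mxE.
by rewrite trmx_inv GS mulmxK// posdef_unitmx.
Qed.

Lemma model_geom p : geom model_X p = T.
Proof.
transitivity (PData g G h (pnu T)); last by rewrite /g /G /h; case: (T).
have hc := chart_at_atlas p; have hd := chart_at_atlas (model_f p).
have cp := chart_at_dom p; have dp := chart_at_dom (model_f p).
rewrite /geom; congr PData.
- by rewrite /induced_metric model_jac_at// model_met_f gE.
- exact: model_met_f.
- apply/funext => i; apply/funext => j.
  rewrite (second_ffE model_X).
  rewrite model_jac_at// model_met_f model_acceleration//.
  rewrite (_ : \row_a _ = 0) ?add0r; last first.
    apply/rowP => a; rewrite [LHS]mxE [RHS]mxE.
    have [k [_ near_k]] := @model_jac _ _ p hc hd cp dp.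
    exact: affine_pderiv2 near_k.
  exact: normal_proj_id (reg_normal _ _ reg i j).
Qed.

(** The linear function dual to [H], read on a lift; it descends to the quotient because [H] is
    taken normal. *)
Definition model_phi (H : 'rV[R]_n) (q : model_N) : R :=
  (H *m G *m (qrepr (q : qsp J))^T) 0 0.

Section Potential.
Variable H : 'rV[R]_n.
Hypothesis HN : H *m G *m J^T = 0.

Lemma model_phi_qpi z : model_phi H (qpi J z) = (H *m G *m z^T) 0 0.
Proof.
have [k kE] : lat J (qrepr (qpi J z) - z) by apply/qpiP; rewrite qreprK.
rewrite /model_phi -(subrK z (qrepr (qpi J z))) kE [(_ + z)^T]raddfD/= mulmxDr.
by rewrite trmx_mul [H *m G *m (J^T *m _)]mulmxA HN mul0mx add0r.
Qed.

Lemma model_phi_f p : model_phi H (model_f p) = 0.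
Proof. by rewrite /model_f model_phi_qpi trmx_mul mulmxA HN mul0mx mxE. Qed.

Lemma model_phi_smooth : smooth_fun (model_phi H).
Proof.
move=> c [a _ <-]; apply: smooth_on_sub.
rewrite (_ : _ \o _ = fun z => (H *m G *m z^T) 0 0); last first.
  by apply/funext => z; exact: model_phi_qpi.
apply: (@mx_smoothM _ _ _ _ _ (fun=> H *m G)); first exact: mx_smooth_cst.
exact: mx_smooth_tr mx_smooth_id.
Qed.

(** On the torus the factor is 1, and the gradient of the linear function is [H], already normal. *)
Lemma model_conformal_geom p :
  geom (conformal model_X (model_phi H)) p = rescale_pdata 1 H T.
Proof.
rewrite (geom_conformal _ _ _ model_immersion model_phi_smooth) model_geom.
rewrite [imm model_X p]/(model_f p) model_phi_f expR0; congr rescale_pdata.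
have hc := chart_at_atlas p; have hd := chart_at_atlas (model_f p).
have cp := chart_at_dom p; have dp := chart_at_dom (model_f p).
rewrite /rescale_shift [imm model_X p]/(model_f p) model_phi_f expR0 invr1 scale1r.
rewrite model_jac_at// model_met_f.
rewrite (_ : \row_a _ = H); first exact: normal_proj_id.
apply/rowP => a; rewrite [LHS]mxE.
transitivity ((H *m G *m (invmx G)^T) 0 a); last first.
  by rewrite trmx_inv GS mulmxK// posdef_unitmx.
rewrite [RHS]mxE; apply: eq_bigr => k _; rewrite [X in _ = _ * X]mxE mulrC; congr (_ * _).
have [b0 _ dE] := hd.
have phiE : (fun y => expR (model_phi H (Defs.inv (chart_at (model_f p)) y))) =
    fun y => expR ((H *m G *m y^T) 0 0).
  by apply/funext => y; rewrite -dE model_phi_qpi.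
rewrite /pderiv [X in derive X]phiE.
set x := to _ _; have phix : (H *m G *m x^T) 0 0 = 0.
  by rewrite -model_phi_qpi model_inv// model_phi_f.
have dphi : is_derive x (delta_mx 0 k) (fun y : 'rV[R]_n => (H *m G *m y^T) 0 0)
    ((H *m G) 0 k).
  apply: (is_derive_quadratic _ _ _ _ 0) => t.
  rewrite [(_ + x)^T]raddfD/= mulmxDr [(t *: _)^T]linearZ/= -scalemxAr trmx_delta -colE.
  by rewrite !mxE mulr0 addr0 addrC.
have := is_derive_expR_comp _ _ _ _ dphi; rewrite phix expR0 mul1r.
by case.
Qed.

End Potential.

(** The induced metric is [g] in all charts, so the density is constant. One measure serves both
    metrics, as the conformal factor is 1 on the torus. *)
Lemma model_volume : exists mu : {measure set (g_sigma_algebraType (@open (src model_X))) -> \bar R},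
  [/\ exists2 c : R, 0 < c & mu setT = c%:E, @volume_measure R m n model_X mu &
     forall phi, (forall p, phi (model_f p) = 0) ->
       @volume_measure R m n (conformal model_X phi) mu].
Proof.
have kap0 : 0 < Num.sqrt (\det g) by rewrite sqrtr_gt0; exact: posdef_det_gt0.
have [mu [muT muE]] := ex_quotient_measure sepM kap0.
have metE c d p : @atlas R m model_M c -> @atlas R n model_N d -> Defs.dom c p ->
    Defs.dom d (model_f p) -> induced_metric model_X c d p = g.
  by move=> hc hd cp dp; rewrite /induced_metric model_jac_at// model_met_f gE.
(* The indicator confines the integrand to the chart, so the matrix field is compared with [g] only
   there. *)
have key c (B : set (g_sigma_algebraType (@open (src model_X)))) (F : model_M -> 'M[R]_m) :
    @atlas R m model_M c -> measurable B -> B `<=` Defs.dom c ->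
    (forall p, Defs.dom c p -> F p = g) ->
    mu B = int_rV (fun x => (\1_(to c @` B) x * Num.sqrt (\det (F (Defs.inv c x))))%:E).
  move=> hc mB Bc Fg; have [a _ ca] := hc; have [_ _ invK _ _] := atlas_chart hc.
  rewrite -ca in Bc *; rewrite (muE a B mB Bc); congr int_rV.
  apply/funext => x; congr _%:E; rewrite indicE.
  have [xB|_] := boolP (x \in _); last by rewrite !mul0r.
  congr (_ * Num.sqrt (\det _)); move: xB; rewrite inE => -[p Bp <-].
  by rewrite ca invK ?Fg// -ca; exact: Bc.
have conf phi c p : (forall p, phi (model_f p) = 0) -> @atlas R m model_M c ->
    Defs.dom c p -> induced_metric (conformal model_X phi) c (chart_at (model_f p)) p = g.
  move=> phi0 hc cp.
  rewrite -[RHS](metE c (chart_at (model_f p)) p hc (chart_at_atlas _) cp (chart_at_dom _)).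
  by rewrite /induced_metric /= phi0 expR0 expr1n scale1r.
exists mu; split=> // [c B hc mB Bc|phi phi0 c B hc mB Bc].
- apply: (key c B (fun p => induced_metric model_X c (chart_at (model_f p)) p)) => // p cp.
  by apply: metE => //; [exact: chart_at_atlas|exact: chart_at_dom].
- apply: (key c B (fun p => induced_metric (conformal model_X phi) c
    (chart_at (model_f p)) p)) => // p cp.
  exact: conf.
Qed.

Lemma model_src_orientable : orientable (src model_X).
Proof.
exists (@atlas R m model_M); split.
- move=> c hc; split=> [|d hd]; first exact: atlas_chart.
  by split; exact: atlas_compatible.
- by move=> p; exists (chart_at p); [exact: chart_at_atlas|exact: chart_at_dom].
- move=> _ _ p [a _ <-] [b _ <-] [x ax <-] bx; rewrite (qchart_toK sepM)//.
  have [k [_ near_k]] := qchart_near sepM bx.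
  rewrite (@affine_jac _ _ _ 1%:M _ k) ?det1//.
  by apply: filterS near_k => y yk; rewrite mulmx1 -yk.
Qed.

Lemma model_src_compact : compact [set: src model_X].
Proof. exact: qsp_compact. Qed.

(** Both integrals are a constant times the same finite positive volume, which cancels. *)
Lemma global_invariant_traceless (Q : @pdata R m n -> R) :
  global_conformal_invariant Q -> Q (traceless T) = Q T.
Proof.
move=> hQ; have [mu [[c c0 muT] vol volc]] := model_volume.
pose H := mean_curvature T.
have HN : H *m G *m J^T = 0.
  rewrite /H /mean_curvature -!scalemxAl !mulmx_suml big1 ?scaler0// => i _.
  rewrite !mulmx_suml big1// => j _.
  by rewrite -!scalemxAl (reg_normal _ _ reg) scaler0.
have := hQ model_X (model_phi H) mu mu model_immersion model_src_compact
  model_src_orientable (model_phi_smooth _ HN) vol (volc _ (model_phi_f _ HN)).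
under eq_integral do rewrite (model_conformal_geom _ HN).
under [RHS]eq_integral do rewrite model_geom.
rewrite !integral_cst// [X in (_ * X = _)%E]muT [X in (_ = _ * X)%E]muT -!EFinM rescale_mean_curvature => -[].
by move/mulIf; apply; rewrite gt_eqF.
Qed.

End Model.

(** * Conclusion *)

Section Conclusion.
Context {R : realType} {m n : nat}.

(** The converse of [geom_regular]; it allows contractions to be tested on chosen data. *)
Lemma regular_realized (T : @pdata R m n) (J : 'M[R]_(m, n)) : regular_pdata T J ->
  exists (X : @submanifold R m n) (p : src X), riemannian_immersion X /\ geom X p = T.
Proof.
move=> reg.
have [rM sepM] : exists r, lat_sep (1%:M : 'M[R]_m) r.
  by apply: lat_sep_ex; rewrite row_free_unit unitmx1.
have [rN sepN] := lat_sep_ex (reg_free _ _ reg).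
exists (model_X T J _ _ sepM sepN), point; split; first exact: model_immersion.
exact: model_geom.
Qed.

(** The torus is built from the data of [X] at [p], and the integral identity is applied to it
    instead of [X]. *)
Lemma global_invariant_pointwise (Q : @pdata R m n -> R) X (p : src X) :
  global_conformal_invariant Q -> riemannian_immersion X ->
  Q (geom X p) = Q (traceless (geom X p)).
Proof.
move=> hQ hX; have reg := geom_regular X p hX.
have [rM sepM] : exists r, lat_sep (1%:M : 'M[R]_m) r.
  by apply: lat_sep_ex; rewrite row_free_unit unitmx1.
have [rN sepN] := lat_sep_ex (reg_free _ _ reg).
exact/esym/(global_invariant_traceless _ _ reg _ _ sepM sepN).
Qed.

(** Flat metrics: the first m basis vectors span the tangent space and v, the next one, is the unit
    normal. *)
Lemma umbilic_regular (hmn : (m < n)%N) (v := delta_mx 0 (Ordinal hmn) : 'rV[R]_n) :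
  regular_pdata (PData 1%:M 1%:M (fun i j : 'I_m => (i == j)%:R *: v) v) (pid_mx m).
Proof.
have vJ : v *m (pid_mx m : 'M[R]_(m, n))^T = 0.
  by apply/rowP => j; rewrite tr_pid_mx -rowE !mxE /= ltnn andbF.
have JJ : (pid_mx m : 'M[R]_(m, n)) *m (pid_mx m : 'M[R]_(m, n))^T = 1%:M.
  by rewrite tr_pid_mx mul_pid_mx minnn (minn_idPr (ltnW hmn)) pid_mx_1.
split=> /=.
- by rewrite mulmx1 JJ.
- exact: trmx1.
- move=> w w0; rewrite mulmx1; have [k0 wk] : exists k0, w 0 k0 != 0 by exact/rV0Pn.
  rewrite mxE (bigD1 k0)//= ltr_pwDl//.
    by rewrite mxE -expr2 exprn_even_gt0.
  by apply: sumr_ge0 => l _; rewrite mxE -expr2 sqr_ge0.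
- by apply/row_freeP; exists (pid_mx m)^T.
- by move=> i j; rewrite mulmx1 -scalemxAl vJ scaler0.
- by move=> i j; rewrite eq_sym.
- move=> _; split; first by rewrite mulmx1 -[LHS]trmxK trmx_mul trmxK vJ trmx0.
  by rewrite mulmx1 -rowE !mxE !eqxx.
Qed.

(** A homothety by 2 of an immersion with the umbilic data: the contraction is nonzero there, so
    2^-nfac = 2^-m. *)
Lemma contr_weight_nfac (C : contr_scheme) : (0 < m < n)%N -> complete_contraction m n C ->
  @has_weight R m n (contr C) (- m%:Z) -> nfac C = m.
Proof.
move=> /andP[m0 hmn] hC hw; have reg := umbilic_regular hmn.
have [X [p [hX XE]]] := regular_realized _ _ reg.
have := hw X p 2 hX (ltr0Sn _ 1).
rewrite (geom_homothety _ _ _ hX (ltr0Sn _ 1)) XE contr_rescale//; last first.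
  by rewrite (regular_unitmx _ _ reg).
have c0 : contr C (PData 1%:M 1%:M (fun i j : 'I_m => (i == j)%:R *: delta_mx 0 (Ordinal hmn))
    (delta_mx 0 (Ordinal hmn))) != 0 :> R.
  rewrite gt_eqF// contr_umbilic_gt0//; apply/matrixP => i j.
  by rewrite !ord1 trmx_delta mul_delta_mx !mxE !eqxx.
move/(mulIf c0); rewrite -exprnN => /invr_inj; apply: ieexprIn => //.
by rewrite -subr_eq0 addrK oner_neq0.
Qed.

Lemma traceless_contr_rescale (C : contr_scheme) (T : @pdata R m n) J s W : (0 < m)%N ->
  complete_contraction m n C -> regular_pdata T J -> s != 0 ->
  contr C (traceless (rescale_pdata s W T)) = s ^- nfac C * contr C (traceless T).
Proof.
move=> m0 hC reg s0; have uT := regular_unitmx _ _ reg.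
rewrite traceless_rescale// ?(regular_pg_sym _ _ reg)//.
exact: contr_rescale.
Qed.

End Conclusion.

Theorem theorem4p1 (R : realType) (m n : nat) (hm : (2 <= m)%N) (hmn : (m < n)%N)
    (L : finType) (a : L -> R) (C : L -> contr_scheme)
    (hC : forall l, complete_contraction m n (C l))
    (hweight : forall l, @has_weight R m n (contr (C l)) (- m%:Z))
    (hP : @global_conformal_invariant R m n (lincomb a C)) :
  (exists (K : finType) (b : K -> R) (D : K -> contr_scheme),
     [/\ forall k, [/\ complete_contraction m n (D k), nfac (D k) = m &
           @has_weight R m n (fun T => contr (D k) (traceless T)) (- m%:Z)],
         @pointwise_conformal_invariant R m n
           (fun T => lincomb b D (traceless T)) (- m%:Z) &
         forall (X : @submanifold R m n) (p : src X), riemannian_immersion X ->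
           lincomb a C (geom X p) = lincomb b D (traceless (geom X p))]) /\
  (forall l, nfac (C l) = m) /\
  (forall (X : @submanifold R m n) (p : src X), riemannian_immersion X ->
     lincomb a C (geom X p) = lincomb a C (traceless (geom X p))).
Proof.
have m0 : (0 < m)%N by exact: leq_trans hm.
have nfacE l : nfac (C l) = m.
  by apply: (contr_weight_nfac (R := R) (n := n)) => //; rewrite m0.
have PE X p (hX : riemannian_immersion X) := global_invariant_pointwise (lincomb a C) X p hP hX.
(* W keeps the coefficients and the pairings of P and is evaluated at the traceless part. *)
split=> //; exists L, a, C; split=> //.
- move=> l; split=> // X p t hX t0.
  rewrite geom_homothety// (traceless_contr_rescale _ _ _ _ _ m0 (hC l) (geom_regular X p hX)) ?gt_eqF//.
  by rewrite nfacE exprnN.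
- move=> X p phi hX sphi; rewrite geom_conformal//.
  have -> : expR ((- m%:Z)%:~R * phi (imm X p)) = expR (phi (imm X p)) ^- m.
    by rewrite intrN mulNr expRN -pmulrn expRM_natl.
  rewrite /lincomb mulr_sumr; apply: eq_bigr => l _.
  rewrite (traceless_contr_rescale _ _ _ _ _ m0 (hC l) (geom_regular X p hX)) ?gt_eqF ?expR_gt0//.
  by rewrite nfacE mulrCA.
Qed.
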